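(* Let $\mathcal{X}$ be a complete, separable, locally compact and non-compact geodesic space, let $p\ge1$, and let $u:\mathcal{X}\to\mathbb{R}$ be a (strong) metric viscosity solution on $\mathcal{X}$. Then the function $\hat u$ defined by $\hat u(\omega)=\int_{\mathcal{X}}u(x)\,d\omega(x)$ for $\omega\in\mathcal{P}_p(\mathcal{X})$ is a strong metric viscosity solution on $\mathcal{P}_p(\mathcal{X})$.
   Context: $\mathcal{P}_p(\mathcal{X})$ is the set of Borel probability measures on $\mathcal{X}$ with finite $p$-th moment, with the $p$-Wasserstein metric $W_p$. A geodesic space is a metric space in which every pair of points is joined by a curve whose length equals their distance. ''(Strong)'' in parentheses means the hypothesis on $u$ may be read with or without the word strong. Metric viscosity solution: for an open set $\Omega$ of a length space $(\mathcal{Y},d)$, a locally Lipschitz function $u:\Omega\to\mathbb{R}$ is a metric viscosity solution if $|\partial u|(y)=1$ for every $y\in\Omega$, where $|\partial u|(y)=\limsup_{x\in\Omega,\,x\to y}\frac{(u(y)-u(x))^+}{d(y,x)}$. It is a strong metric viscosity solution if moreover for each $y\in\Omega$ there exists at least one negative gradient curve of $u$ starting from $y$. (Here $\Omega$ is the whole space.) Negative gradient curve: a regular curve $\gamma:I\to\mathcal{Y}$ ($I$ a non-degenerate interval) such that $u(\gamma(t_1))-u(\gamma(t_2))=d(\gamma(t_2),\gamma(t_1))$ for any $[t_1,t_2]\subset I$. A regular curve is a continuous curve that has finite length on each bounded closed subinterval and whose metric speed $|\gamma'|(t)=\lim_{\tau\to0}d(\gamma(t+\tau),\gamma(t))/|\tau|$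 is nonzero for a.e. $t\in I$. *)

(* Defs.v *)
From HB Require Import structures.
From mathcomp Require Import all_boot all_order all_algebra.
From mathcomp Require Import all_classical all_reals all_analysis.

Set Implicit Arguments.
Unset Strict Implicit.
Unset Printing Implicit Defensive.

Import Order.TTheory GRing.Theory Num.Theory.
Import numFieldNormedType.Exports.

Local Open Scope classical_set_scope.
Local Open Scope ring_scope.

#[short(type="completeMetricType")]
HB.structure Definition CompleteMetric (K : numDomainType) :=
  {T of Complete T & Metric K T}.

Definition separable (T : topologicalType) : Prop :=
  exists2 A : set T, countable A & dense A.

(* These notions take the distance as a function [d], because they are applied
   both to [mdist] and to the Wasserstein distance, for which no [metricType]
   structure is built. Curves are total functions on [R] of which only the
   values on the interval [I] matter. *)
Section MetricNotions.
Variables (R : realType) (Y : Type) (d : Y -> Y -> R).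
Implicit Types (I : set R) (g : R -> Y) (u : Y -> R).

(* Same summation as [variation] in [numfun], with [d] as the distance. *)
Definition curve_length (a b : R) g : \bar R :=
  ereal_sup [set (\sum_(0 <= n < size s)
                    d (g (nth b (a :: s) n)) (g (nth b (a :: s) n.+1)))%:E
            | s in itv_partition a b].

Definition curve_continuous I g : Prop :=
  forall t, I t -> d (g s) (g t) @[s --> within I (nbhs t)] --> 0.

Definition geodesic_space : Prop :=
  forall x y : Y, exists a b : R, exists g : R -> Y,
    [/\ a < b, curve_continuous `[a, b] g, g a = x, g b = y
      & curve_length a b g = (d x y)%:E].

Definition has_metric_speed I g (t v : R) : Prop :=
  d (g (t + h)) (g t) / `|h| @[h --> within [set h | I (t + h)] 0^'] --> v.

Definition regular_curve I g : Prop :=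
  [/\ curve_continuous I g,
      forall a b, a <= b -> `[a, b] `<=` I -> (curve_length a b g < +oo)%E
    & {ae (@lebesgue_measure R), forall t, I t ->
         exists2 v, has_metric_speed I g t v & v != 0}].

Definition nondegenerate_interval I : Prop :=
  is_interval I /\ exists s t, [/\ I s, I t & s < t].

Definition negative_gradient_curve u I g : Prop :=
  [/\ nondegenerate_interval I, regular_curve I g
    & forall t1 t2, t1 <= t2 -> `[t1, t2] `<=` I ->
        u (g t1) - u (g t2) = d (g t2) (g t1)].

(* [limf_esup] along the filter generated by the punctured [d]-balls at [y]; it
   cannot be used literally because [Y] carries no filtered structure. *)
Definition descending_slope u (y : Y) : \bar R :=
  ereal_inf [set ereal_sup [set (Num.max (u y - u x) 0 / d y x)%:E
                           | x in [set x | 0 < d y x < r]]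
            | r in [set r | 0 < r]].

Definition locally_lipschitz u : Prop :=
  forall y : Y, exists2 r : R, 0 < r & exists L : R,
    forall x z, d y x < r -> d y z < r -> `|u x - u z| <= L * d x z.

Definition metric_viscosity_solution u : Prop :=
  locally_lipschitz u /\ forall y, descending_slope u y = 1%E.

Definition strong_metric_viscosity_solution u : Prop :=
  metric_viscosity_solution u /\
  forall y, exists (I : set R) (g : R -> Y) (t0 : R),
    [/\ negative_gradient_curve u I g, I t0, lbound I t0 & g t0 = y].

End MetricNotions.

Notation borel X := (g_sigma_algebraType (@open X)).

Section Wasserstein.
Variables (R : realType) (X : completeMetricType R) (p : R).

Definition finite_moment (w : probability (borel X) R) : Prop :=
  exists x0 : X, (\int[w]_x ((mdist (x : X) x0) `^ p)%:E < +oo)%E.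

Definition wasserstein_space : Type :=
  {w : probability (borel X) R | finite_moment w}.

(* For separable [X] the product sigma-algebra of [borel X * borel X] is the
   Borel sigma-algebra of the product space. *)
Definition couplings (mu nu : probability (borel X) R) :
    set (probability (borel X * borel X)%type R) :=
  [set pi | forall A : set (borel X), measurable A ->
     pi (A `*` setT) = mu A /\ pi (setT `*` A) = nu A].

Definition wasserstein_dist (mu nu : wasserstein_space) : R :=
  fine (ereal_inf [set (\int[pi]_z ((mdist (z.1 : X) z.2) `^ p)%:E)%E
                  | pi in couplings (sval mu) (sval nu)]) `^ p^-1.

Definition integral_functional (u : X -> R) (w : wasserstein_space) : R :=
  \int[sval w]_x u x.

End Wasserstein.

Arguments wasserstein_space {R} X p.
Arguments wasserstein_dist {R} X p.
Arguments integral_functional {R X} p u.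

(* Main.v *)
From HB Require Import structures.
Require Import Defs.
From mathcomp Require Import all_boot all_order all_algebra.
From mathcomp Require Import all_classical all_reals all_analysis.
From mathcomp Require Import measurable_realfun lra zify.

Import Order.TTheory GRing.Theory Num.Theory.
Import numFieldNormedType.Exports.

Local Open Scope classical_set_scope.
Local Open Scope ring_scope.

Set Implicit Arguments.
Unset Strict Implicit.
Unset Printing Implicit Defensive.

(* On a geodesic space a function whose descending slope is 1 everywhere is
   1-Lipschitz. In a complete, locally compact space such a [u] moreover admits,
   from every [x] and for every [r >= 0], a point [y] with
   [d x y = r = u x - u y] (minimize [u] on small compact balls, then Zorn).
   The Kuratowski-Ryll-Nardzewski theorem makes the choice of [y] for [r = 1],
   and the choice of midpoints, measurable; iterating the former and refining
   dyadically by the latter gives measurable maps [gamma t], [t >= 0], such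
   that every [t |-> gamma t x] is a unit speed negative gradient ray of [u]
   from [x].
   Then [t |-> (gamma t)_# w] is such a ray for the integral functional: the
   law of [(gamma s, gamma t)] under [w] is a coupling of cost [`|s - t| ^ p],
   whereas the functional decreases by [t - s] and is 1-Lipschitz for the
   Wasserstein distance by Hoelder's inequality. These rays also show that its
   descending slope is 1. *)

(** * Slopes and geodesics *)

Section Slope.
Context {R : realType} {Y : Type}.
Variables (d : Y -> Y -> R) (u : Y -> R).

Lemma descending_slope_ltP y c : (descending_slope d u y < c%:E)%E ->
  exists2 r, 0 < r & forall z, 0 < d y z < r -> u y - u z <= c * d y z.
Proof.
move=> /ereal_inf_lt[_ [r /= r0 <-] supc]; exists r => // z yz.
have /andP[yz0 _] := yz.
have: ((Num.max (u y - u z) 0 / d y z)%:E < c%:E)%E.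
  by apply: le_lt_trans supc; apply: ereal_sup_ubound; exists z.
rewrite lte_fin ltr_pdivrMr// gt_max => /andP[/ltW + _].
by [].
Qed.

(** The sign of [c] rules out the points where the positive part in the slope is [0], so the
    inequality concerns the true difference of [u]. *)
Lemma descending_slope_gtP y c r : 0 <= c -> 0 < r ->
  (c%:E < descending_slope d u y)%E ->
  exists2 z, 0 < d y z < r & c * d y z < u y - u z.
Proof.
move=> c0 r0 cs.
have /ereal_sup_gt[_ [z /= yz <-]] : (c%:E <
    ereal_sup [set (Num.max (u y - u x) 0 / d y x)%:E
              | x in [set x | (0 < d y x < r)%R]])%E.
  by apply: lt_le_trans cs _; apply: ereal_inf_lbound; exists r.
have /andP[yz0 _] := yz.
rewrite lte_fin ltr_pdivlMr// => czy; exists z => //.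
move: czy; rewrite lt_max => /orP[//|].
by rewrite ltNge mulr_ge0// ltW.
Qed.

Lemma descending_slope_le1 y :
  (forall z, `|u y - u z| <= d y z) -> (descending_slope d u y <= 1)%E.
Proof.
move=> lip; apply: (@le_trans _ _ (ereal_sup
    [set (Num.max (u y - u x) 0 / d y x)%:E | x in [set x | 0 < d y x < 1]])).
  by apply: ereal_inf_lbound; exists 1 => //=; exact: ltr01.
apply: ge_ereal_sup => _ [z /= /andP[yz _] <-].
rewrite lee_fin ler_pdivrMr// mul1r ge_max (ltW yz) andbT.
exact: le_trans (ler_norm _) (lip z).
Qed.

Lemma descending_slope_ge1 y :
  (forall r, 0 < r -> exists2 z, 0 < d y z < r & u y - u z = d y z) ->
  (1 <= descending_slope d u y)%E.
Proof.
move=> hz; apply: le_ereal_inf_tmp => _ [r /= r0 <-].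
have [z yz uyz] := hz r r0; have /andP[yz0 _] := yz.
apply: ereal_sup_ubound; exists z => //.
by rewrite uyz max_l ?divff ?gt_eqF ?ltW.
Qed.

End Slope.

(** * Convergence and completeness in terms of the distance *)

Section MetricConvergence.
Context {R : realType} {X : metricType R}.
Local Notation d := (@mdist R X).

Lemma ler_dist_mdist (x y z : X) : `|d x y - d x z| <= d y z.
Proof.
rewrite ler_norml; apply/andP; split.
  by rewrite lerNl opprB lerBlDr addrC metric_triangle.
by rewrite lerBlDr addrC (metric_sym y z) metric_triangle.
Qed.

Lemma cvg_mdist {T} {F : set_system T} {FF : Filter F} (f g : T -> X) x y :
  f @ F --> x -> g @ F --> y -> d (f t) (g t) @[t --> F] --> d x y.
Proof.
move=> fx gy; apply/cvgrPdist_le => e e0.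
have e2 : 0 < e / 2 by rewrite divr_gt0.
near=> t.
have xf : d x (f t) <= e / 2 by near: t;
  exact: metricType_numDomainType.cvgr_dist_le.
have yg : d y (g t) <= e / 2 by near: t;
  exact: metricType_numDomainType.cvgr_dist_le.
have := ler_dist_mdist x y (g t); have := ler_dist_mdist (g t) x (f t).
rewrite (metric_sym (g t) x) (metric_sym (g t) (f t)) => h1 h2.
have -> : d x y - d (f t) (g t) =
  (d x y - d x (g t)) + (d x (g t) - d (f t) (g t)) by lra.
by rewrite (le_trans (ler_normD _ _))//; lra.
Unshelve. all: by end_near. Qed.

Lemma lipschitz_continuous (u : X -> R) :
  (forall x y, `|u x - u y| <= d x y) -> continuous u.
Proof.
move=> ulip x; apply/cvgrPdist_le => e e0.
near=> y; apply: (le_trans (ulip x y)); near: y.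
by apply: (metricType_numDomainType.cvgr_dist_le (f := id)).
Unshelve. all: by end_near. Qed.

Lemma open_mdistP (O : set X) : open O <->
  forall x, O x -> exists2 r, 0 < r & forall y, d x y < r -> O y.
Proof.
rewrite openE; split=> [oO x /oO|hO x /hO[r r0 rO]].
  by rewrite /interior => /nbhs_ballP[r /= r0]; rewrite ballEmdist; exists r.
by apply/nbhs_ballP; exists r => //=; rewrite ballEmdist.
Qed.

Lemma closed_ball_mdist (x : X) r : closed [set y | d x y <= r].
Proof.
apply: (@preimage_closed _ _ (d x) [set s | s <= r]); last exact: closed_le.
by move=> y _; apply: cvg_mdist; [exact: cvg_cst|exact: cvg_id].
Qed.

End MetricConvergence.

Section CompleteMetricConvergence.
Context {R : realType} {X : completeMetricType R}.
Local Notation d := (@mdist R X).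

Lemma mdist_cauchy_cvg (z : nat -> X) :
  (forall e, 0 < e -> exists N, forall n, (N <= n)%N -> d (z N) (z n) < e) ->
  exists l : X, z @ \oo --> l.
Proof.
move=> zC; suff cz : [cvg z @ \oo in X] by eexists; exact: cz.
apply: cauchy_cvg; apply/(cauchy_exP (R := R)) => e e0.
have [N Ne] := zC e e0; exists (z N); exists N => // n /= Nn.
by rewrite ballEmdist; exact: Ne.
Qed.

Lemma mdist_geometric_cvg (z : nat -> X) (C : R) :
  (forall n, d (z n) (z n.+1) <= C * 2^-1 ^+ n) ->
  exists2 l : X, z @ \oo --> l & forall n, d (z n) l <= 2 * C * 2^-1 ^+ n.
Proof.
move=> zS.
have C0 : 0 <= C by have := zS 0; rewrite expr0 mulr1;
  exact: le_trans (mdist_ge0 _ _).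
(* The exact partial geometric sum is kept so that the induction on [k] closes. *)
have zD n k : d (z n) (z (n + k)%N) <= 2 * C * 2^-1 ^+ n * (1 - 2^-1 ^+ k).
  elim: k => [|k IH]; first by rewrite addn0 mdistxx subrr mulr0.
  apply: (le_trans (metric_triangle _ (z (n + k)%N) _)).
  rewrite addnS; apply: (le_trans (lerD IH (zS _))).
  rewrite exprD exprS; set a := _ ^+ n; set b := _ ^+ k.
  by rewrite le_eqVlt; apply/orP; left; apply/eqP; lra.
have zb n k : d (z n) (z (n + k)%N) <= 2 * C * 2^-1 ^+ n.
  apply: (le_trans (zD n k)); apply: ler_piMr; last by rewrite gerBl exprn_ge0.
  by rewrite !mulr_ge0// exprn_ge0.
have [|l zl] := @mdist_cauchy_cvg z.
  move=> e e0.
  have /cvgrPdist_lt/(_ e e0)[N _ hN] :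
      2 * C * 2^-1 ^+ n @[n --> \oo] --> 0.
    rewrite -(mulr0 (2 * C)); apply: cvgM; first exact: cvg_cst.
    by apply: cvg_expr; rewrite ger0_norm// invf_lt1// ltr1n.
  exists N => n Nn; rewrite -(subnKC Nn); apply: (le_lt_trans (zb _ _)).
  have := hN N (leqnn _); rewrite /= sub0r normrN; exact/le_lt_trans/ler_norm.
exists l => // n; apply: (closed_cvg (fun s => s <= _) (@closed_le _ _) _ _
  (cvg_mdist (cvg_cst (z n)) zl)).
by exists n => // m /= nm; rewrite -(subnKC nm).
Qed.

End CompleteMetricConvergence.

(** * Geodesics and the global Lipschitz bound *)

Section Geodesics.
Context {R : realType} {X : metricType R}.
Local Notation d := (@mdist R X).

Lemma curve_length_ge2 (a b : R) (g : R -> X) s : a < s < b ->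
  ((d (g a) (g s) + d (g s) (g b))%:E <= curve_length d a b g)%E.
Proof.
move=> /andP[as_ sb]; apply: ereal_sup_ubound; exists [:: s; b].
  by split; rewrite /= ?as_ ?sb.
by rewrite /= !big_nat_recl// big_geq//= addr0.
Qed.

Lemma curve_length_ge3 (a b : R) (g : R -> X) s t : a < s -> s < t -> t < b ->
  ((d (g a) (g s) + d (g s) (g t) + d (g t) (g b))%:E <=
   curve_length d a b g)%E.
Proof.
move=> as_ st tb; apply: ereal_sup_ubound; exists [:: s; t; b].
  by split; rewrite /= ?as_ ?st ?tb.
by rewrite /= !big_nat_recl// big_geq//= addr0 addrA.
Qed.

(** The three pieces cut out by [s] and [t] add up to at most the length [d (g a) (g b)], so the
    triangle inequalities are equalities. Degenerate positions are treated apart because the points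
    of a partition increase strictly. *)
Lemma geodesic_mdist (a b : R) (g : R -> X) s t :
  curve_length d a b g = (d (g a) (g b))%:E -> a <= s -> s <= t -> t <= b ->
  d (g s) (g t) = d (g a) (g t) - d (g a) (g s).
Proof.
move=> gE as_ st tb.
have L2 r : a < r < b -> d (g a) (g r) + d (g r) (g b) <= d (g a) (g b).
  by rewrite -lee_fin -gE; exact: curve_length_ge2.
suff : d (g a) (g s) + d (g s) (g t) + d (g t) (g b) <= d (g a) (g b).
  have := metric_triangle (g a) (g s) (g t).
  by have := metric_triangle (g a) (g t) (g b); lra.
have [->|sa] := eqVneq s a.
  rewrite mdistxx add0r; have [->|ta] := eqVneq t a;
    first by rewrite mdistxx add0r.
  have [->|tNb] := eqVneq t b; first by rewrite mdistxx addr0.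
  by apply: L2; rewrite !lt_neqAle tb tNb eq_sym ta (le_trans as_ st).
have {sa}as1 : a < s by rewrite lt_neqAle eq_sym sa.
have [->|tNb] := eqVneq t b.
  rewrite mdistxx addr0; have [->|sNb] := eqVneq s b.
    by rewrite mdistxx addr0.
  by apply: L2; rewrite as1 lt_neqAle sNb (le_trans st tb).
have {tNb}tb1 : t < b by rewrite lt_neqAle tNb.
have [<-|sNt] := eqVneq s t.
  by rewrite mdistxx addr0; apply: L2; rewrite as1 (le_lt_trans st tb1).
rewrite -lee_fin -gE; apply: curve_length_ge3 => //.
by rewrite lt_neqAle sNt.
Qed.

Lemma curve_continuous_within (a b : R) (g : R -> X) :
  curve_continuous d `[a, b] g -> {within `[a, b], continuous g}.
Proof.
move=> cg; apply/subspace_continuousP => t tab.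
apply/metricType_numDomainType.cvgrPdist_le => e e0.
have /cvgrPdist_le/(_ e e0) := cg t tab; apply: filterS => s.
by rewrite sub0r normrN ger0_norm ?mdist_ge0// metric_sym.
Qed.

(** The intermediate value theorem, applied to the distance from [g a] along a geodesic, finds a
    point at half the distance; [geodesic_mdist] gives the other half. *)
Lemma geodesic_midpoint (x y : X) : geodesic_space d ->
  exists m, d x m = d x y / 2 /\ d m y = d x y / 2.
Proof.
move=> /(_ x y)[a [b [g [ab cg <- <- gE]]]].
have cd : {within `[a, b], continuous (fun t => d (g a) (g t))}.
  apply/subspace_continuousP => t tab; apply: cvg_mdist; first exact: cvg_cst.
  by move/curve_continuous_within/subspace_continuousP : cg; exact.
have [|c cab gc] := IVT (ltW ab) cd (v := d (g a) (g b) / 2).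
  rewrite mdistxx; have := mdist_ge0 (g a) (g b) => D0.
  by rewrite min_l// max_r//; lra.
exists (g c); split=> //; move: cab; rewrite in_itv/= => /andP[ac cb].
by rewrite (geodesic_mdist gE ac cb (lexx b)) gc; lra.
Qed.

(* With [h t = u (g t) + (1 + e) d (g a) (g t)], the bound on the slope gives
   [h c <= h t] for [t] slightly to the right of [c]; so the last [c] with
   [h a <= h c] can only be [b]. *)
Lemma slope_le1_descent (u : X -> R) (x y : X) (e : R) :
  geodesic_space d -> continuous u -> 0 < e ->
  (forall z, (descending_slope d u z <= 1)%E) ->
  u x - u y <= (1 + e) * d x y.
Proof.
move=> /(_ x y)[a [b [g [ab cg <- <- gE]]]] cu e0 su.
pose h t := u (g t) + (1 + e) * d (g a) (g t).
have cg' := curve_continuous_within cg.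
have ch : {within `[a, b], continuous h}.
  apply/subspace_continuousP => t tab.
  have gt : g s @[s --> within `[a, b] (nbhs t)] --> g t.
    by move/subspace_continuousP : cg'; exact.
  apply: cvgD; first exact: (cvg_comp _ _ gt (cu _)).
  by apply: cvgM; [exact: cvg_cst|apply: cvg_mdist => //; exact: cvg_cst].
suff : h a <= h b by rewrite /h mdistxx mulr0 addr0; lra.
pose A := [set t | t \in `[a, b] /\ h a <= h t].
have Aa : A a by split=> //; rewrite in_itv/= lexx ltW.
have supA : has_sup A.
  split; first by exists a.
  by exists b => t [] /=; rewrite in_itv/= => /andP[].
pose c : R := sup A.
have ac : a <= c by exact: sup_upper_bound.
have cb : c <= b.
  by apply: ge_sup; [exists a|move=> t [] /=; rewrite in_itv/= => /andP[]].
have cab : c \in `[a, b] by rewrite in_itv/= ac.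
(* Otherwise [h < h a] near [c] by continuity, although points of [A] come arbitrarily close to the
   supremum [c]. *)
have hc : h a <= h c.
  rewrite leNgt; apply/negP => hca.
  have e'0 : 0 < h a - h c by rewrite subr_gt0.
  move/subspace_continuousP : (ch) => /(_ c cab)/cvgrPdist_lt/(_ _ e'0).
  rewrite near_withinE => /nbhs_ballP[r /= r0 hr].
  have [s As cs] := sup_adherent r0 supA.
  have [sab has] := As; have sc : s <= c by exact: sup_upper_bound.
  have /hr/(_ sab) : ball c r s.
    by rewrite /ball/= ger0_norm ?subr_ge0//; move: cs; rewrite -/c; lra.
  by rewrite ltr_norml opprB ltrD2l ltrN2 ltNge has.
have [<-//|cNb] := eqVneq c b.
have {cNb} cb1 : c < b by rewrite lt_neqAle cNb.
have [|r r0 hr] := @descending_slope_ltP _ _ d u (g c) (1 + e).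
  by apply: le_lt_trans (su _) _; rewrite lte_fin ltrDl.
have gc : g s @[s --> within `[a, b] (nbhs c)] --> g c.
  by move/subspace_continuousP : cg'; exact.
have : \forall s \near c, s \in `[a, b] -> d (g c) (g s) < r.
  exact: metricType_numDomainType.cvgr_dist_lt gc r r0.
move=> /nbhs_ballP[q /= q0 hq].
(* A point of the interval strictly to the right of [c], so close that [g s] lies in the ball where
   the slope bound holds. *)
pose s := Num.min b (c + q / 2).
have cs : c < s by rewrite lt_min cb1 ltrDl divr_gt0.
have sab : s \in `[a, b].
  by rewrite in_itv/= ge_min lexx andbT (le_trans ac (ltW cs)).
have /hq/(_ sab) gcs : ball c q s.
  rewrite /ball/= distrC gtr0_norm ?subr_gt0//.
  by rewrite ltrBlDl gt_min (@ltrD2l R c) (_ : q / 2 < q) ?orbT//; lra.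
suff hcs : h c <= h s.
  have : s <= c by apply: sup_upper_bound => //; split=> //;
    exact: le_trans hcs.
  by rewrite leNgt cs.
have sb : s <= b by rewrite ge_min lexx.
have gcsE := geodesic_mdist gE ac (ltW cs) sb.
have : u (g c) - u (g s) <= (1 + e) * d (g c) (g s).
  (* The slope only sees punctured balls; if [g s = g c] the bound is trivial. *)
  have [dcs|dcs] := ltP 0 (d (g c) (g s)); first by apply: hr; rewrite dcs.
  have dcs0 : d (g c) (g s) = 0 by apply/le_anti; rewrite dcs mdist_ge0.
  by rewrite (mdist_positivity _ _ dcs0) mdistxx subrr mulr0.
by rewrite gcsE mulrBr /h; lra.
Qed.

Lemma slope_le1_lipschitz (u : X -> R) :
  geodesic_space d -> continuous u ->
  (forall z, (descending_slope d u z <= 1)%E) ->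
  forall x y, `|u x - u y| <= d x y.
Proof.
move=> gX cu su; have lip x y : u x - u y <= d x y.
  apply/ler_addgt0Pl => e e0.
  (* Taking [e / (d x y + 1)] as the slack keeps the total error below [e], also when [x = y]. *)
  have D0 : 0 < d x y + 1 by rewrite ltr_wpDl ?mdist_ge0.
  apply: (le_trans (slope_le1_descent x y gX cu (divr_gt0 e0 D0) su)).
  rewrite mulrDl mul1r addrC lerD2r -mulrA ler_piMr ?(ltW e0)//.
  by rewrite mulrC ler_pdivrMr// mul1r lerDl.
move=> x y; rewrite ler_norml lip andbT lerNl opprB metric_sym.
exact: lip.
Qed.

End Geodesics.

(** * Points realizing the descent *)

Section LocallyCompact.
Context {R : realType} {X : metricType R}.
Local Notation d := (@mdist R X).

Lemma locally_compact_ball : locally_compact [set: X] ->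
  forall x : X, exists2 r, 0 < r & compact [set y | d x y <= r].
Proof.
move=> lX x; have [U xU [cU clU]] := lX x Logic.I.
have : nbhs x U by apply: (@filterS _ _ _ (fun y => [set: X] y -> U y)) =>
  [y|]; [exact|exact: xU].
move=> /nbhs_ballP[r /= r0 xrU]; exists (r / 2); first by rewrite divr_gt0.
apply: (subclosed_compact _ cU) => [|y /= xy]; first exact: closed_ball_mdist.
by apply: xrU; rewrite ballEmdist/=; lra.
Qed.

(** Let [y] minimize [u] on the ball and, for [c < 1], let [z] minimize [u + c d x]. Were [z] inside
    the sphere, the slope at [z], larger than [c], would give a strictly better point of the ball.
    So [d x z = r], and comparison with [x] gives [u x - u y >= c r]; let [c] tend to [1]. *)
Lemma descent_sphere (u : X -> R) x r : 0 < r ->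
  compact [set y | d x y <= r] -> (forall y z, `|u y - u z| <= d y z) ->
  (forall y, (1 <= descending_slope d u y)%E) ->
  exists y, d x y = r /\ u x - u y = r.
Proof.
move=> r0 cK ulip su; set K := [set y | _] in cK.
have Kx : K x by rewrite /K/= mdistxx ltW.
have cu := lipschitz_continuous ulip.
have [y] : exists2 y, y \in K & forall t, t \in K -> u y <= u t.
  by apply: compact_EVT_min => //; [exists x|exact: continuous_subspaceT].
rewrite inE => Ky ymin.
suff uxy : r <= u x - u y.
  have xyr : d x y = r.
    apply/le_anti; rewrite Ky/=; apply: le_trans uxy _.
    exact: le_trans (ler_norm _) (ulip x y).
  exists y; split=> //; apply/le_anti; rewrite uxy andbT -xyr.
  exact: le_trans (ler_norm _) (ulip x y).
apply/ler_addgt0Pl => e e0.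
(* Chosen so that [c r >= r - e]; the maximum provides the nonnegativity needed by
   [descending_slope_gtP]. *)
pose c := Num.max 0 (1 - e / r).
have c0 : 0 <= c by rewrite le_max lexx.
have c1 : c < 1 by rewrite gt_max ltr01 ltrBlDr ltrDl divr_gt0.
have [z] : exists2 z, z \in K &
    forall t, t \in K -> u z + c * d x z <= u t + c * d x t.
  apply: compact_EVT_min => //; first by exists x.
  apply: continuous_subspaceT => t; apply: cvgD; first exact: cu.
  apply: cvgM; first exact: cvg_cst.
  by apply: cvg_mdist; [exact: cvg_cst|exact: cvg_id].
rewrite inE => Kz zmin.
have xz : d x z = r.
  apply/eqP; rewrite eq_le Kz/= leNgt; apply/negP => xz.
  have [||w] := @descending_slope_gtP _ _ d u z c (r - d x z) c0.
  - by rewrite subr_gt0.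
  - by apply: lt_le_trans (su z); rewrite lte_fin.
  move=> /andP[_ zw] uzw.
  have xw := metric_triangle x z w.
  have /zmin : w \in K by rewrite inE /K/=; lra.
  have : c * d x w <= c * (d x z + d z w) by rewrite ler_wpM2l.
  by lra.
have := zmin x (mem_set Kx); rewrite xz mdistxx mulr0 addr0.
have := ymin z (mem_set Kz).
have : r - e <= c * r.
  rewrite (_ : r - e = (1 - e / r) * r); last first.
    by rewrite mulrBl mul1r divfK// gt_eqF.
  by rewrite ler_wpM2r ?(ltW r0)// le_max lexx orbT.
by lra.
Qed.

End LocallyCompact.

Section Descent.
Context {R : realType} {X : completeMetricType R}.
Local Notation d := (@mdist R X).
Variable u : X -> R.
Hypothesis lX : locally_compact [set: X].
Hypothesis ulip : forall x y, `|u x - u y| <= d x y.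
Hypothesis su : forall y, (1 <= descending_slope d u y)%E.

Let le_sub y z : u y - u z <= d y z.
Proof. exact: le_trans (ler_norm _) (ulip y z). Qed.

Lemma descent_trans x y z : d x y = u x - u y -> d y z = u y - u z ->
  d x z = u x - u z.
Proof.
move=> xy yz; apply/le_anti; rewrite le_sub andbT.
by apply: (le_trans (metric_triangle x y z)); rewrite xy yz; lra.
Qed.

(** Upper bounds of chains for Zorn's lemma. As [u] is isometric on [C], a sequence of [C] along
    which [u] tends to its infimum is Cauchy; the distance equalities pass to its limit. *)
Lemma descent_chain_ub (C : set X) m :
  C !=set0 -> (forall y, C y -> m <= u y) ->
  (forall y z, C y -> C z -> d y z = `|u y - u z|) ->
  exists2 z, m <= u z & forall y, C y -> d y z = u y - u z.
Proof.
move=> [x0 Cx0] mC Ciso.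
have infC : has_inf (u @` C).
  by split; [exists (u x0), x0|exists m => _ [y Cy <-]; exact: mC].
set i := inf (u @` C).
have Ci y : C y -> i <= u y by move=> Cy; apply: inf_lbound;
  [case: infC|exists y].
have /choice[z hz] n : exists z, C z /\ u z < i + n.+1%:R^-1.
  have [|_ [z Cz <-] zi] := @inf_adherent _ _ n.+1%:R^-1 _ infC.
    by rewrite invr_gt0.
  by exists z.
have [|l zl] := @mdist_cauchy_cvg _ _ z.
  move=> e e0; have /cvgrPdist_lt/(_ e e0)[N _ hN] := @cvg_harmonic R.
  exists N => n Nn; have [CN zN] := hz N; have [Cn zn] := hz n.
  have := hN N (leqnn _); have := hN n Nn.
  rewrite /harmonic/= !sub0r !normrN !ger0_norm// => hn hN'.
  rewrite (Ciso _ _ CN Cn) ltr_norml ltrNl opprB.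
  have close v w : i <= v -> w < i + e -> w - v < e.
    by move=> iv we; rewrite ltrBlDr addrC (lt_le_trans we)// lerD2r.
  rewrite !close ?Ci//.
    by rewrite (lt_trans zN)// ltrD2l.
  by rewrite (lt_trans zn)// ltrD2l.
have ul : u l = i.
  have uz : u (z n) @[n --> \oo] --> u l.
    by apply: continuous_cvg => //; exact: lipschitz_continuous.
  apply: (cvg_unique _ uz) => //.
  apply: (@squeeze_cvgr _ _ _ _ (fun=> i) (fun n => i + harmonic n)).
  - by near=> n; have [Cn /ltW zn] := hz n; rewrite Ci.
  - exact: cvg_cst.
  - rewrite -[X in _ --> X]addr0; apply: cvgD; first exact: cvg_cst.
    exact: cvg_harmonic.
exists l; first by rewrite ul; apply: lb_le_inf;
  [exists (u x0), x0|move=> _ [y Cy <-]; exact: mC].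
move=> y Cy; have : d y (z n) @[n --> \oo] --> d y l.
  by apply: cvg_mdist => //; exact: cvg_cst.
have : `|u y - u (z n)| @[n --> \oo] --> `|u y - u l|.
  apply: cvg_norm; apply: cvgB; first exact: cvg_cst.
  by apply: continuous_cvg => //; exact: lipschitz_continuous.
under eq_fun do rewrite -(Ciso _ _ Cy (hz _).1).
move=> h1 h2; rewrite (cvg_unique _ h2 h1)// ger0_norm// subr_ge0 ul.
exact: Ci.
Unshelve. all: by end_near. Qed.

(* Zorn's lemma for the order [u y - u z = d y z] on the points of the ball of
   radius [r] that realize the descent from [x]: a maximal one lies on the
   sphere, since otherwise [descent_sphere] continues it. *)
Lemma descent_exists x r : 0 <= r -> exists y, d x y = r /\ u x - u y = r.
Proof.
move=> r0.
pose S := {y : X | d x y = u x - u y /\ u x - r <= u y}.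
pose le (y z : S) := `[< d (sval y) (sval z) = u (sval y) - u (sval z) >].
have Sx : d x x = u x - u x /\ u x - r <= u x.
  by rewrite mdistxx subrr gerBl.
have [|||C Ctot|[y [xy yr]] ymax] := @Zorn S le.
- by move=> y; apply/asboolP; rewrite mdistxx subrr.
- move=> y z w /asboolP yz /asboolP zw; apply/asboolP.
  exact: descent_trans yz zw.
- move=> [y Sy] [z Sz] /asboolP/= yz /asboolP/= zy.
  have yz0 : y = z.
    by apply: mdist_positivity; have := metric_sym y z; lra.
  by move: yz0 Sy Sz {yz zy} => -> Sy Sz; congr exist; exact: Prop_irrelevance.
(* The empty chain is bounded by [x] itself. *)
- have [[y0 Cy0]|C0] := pselect (C !=set0); last first.
    by exists (exist _ x Sx) => y Cy; exfalso; apply: C0; exists y.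
  have [|_ [y _ <-]|_ _ [y Cy <-] [z Cz <-]|z zr zC] :=
      @descent_chain_ub (sval @` C) (u x - r).
  + by exists (sval y0), y0.
  + exact: (svalP y).2.
  + have [/asboolP yz|/asboolP zy] := Ctot y z Cy Cz.
      by rewrite yz ger0_norm// -yz mdist_ge0.
    by rewrite metric_sym zy distrC ger0_norm// -zy mdist_ge0.
  have Sz : d x z = u x - u z /\ u x - r <= u z.
    split=> //; apply: descent_trans (svalP y0).1 _.
    by apply: zC; exists y0.
  by exists (exist _ z Sz) => y Cy; apply/asboolP/zC; exists y.
suff ryx : u y <= u x - r.
  by exists y; rewrite xy; split; lra.
rewrite leNgt; apply/negP => ry.
have [q q0 cK] := locally_compact_ball lX y.
(* Small enough for the ball around [y] to be compact and for a further drop by [s] to stay above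
   [u x - r]. *)
pose s := Num.min q (u y - (u x - r)).
have s0 : 0 < s by rewrite lt_min q0 subr_gt0.
have [|z [yz uyz]] := @descent_sphere _ _ u y s s0 _ ulip su.
  apply: subclosed_compact cK _; first exact: closed_ball_mdist.
  by move=> z /= /le_trans; apply; rewrite ge_min lexx.
have Sz : d x z = u x - u z /\ u x - r <= u z.
  split; first by apply: (descent_trans xy); rewrite yz uyz.
  have : s <= u y - (u x - r) by rewrite ge_min lexx orbT.
  by lra.
have := ymax (exist _ z Sz);
  have -> : le (exist _ y (conj xy yr)) (exist _ z Sz).
  by apply/asboolP; rewrite /= yz uyz.
move=> /(_ isT) [zy].
by move: yz; rewrite zy mdistxx => s0'; rewrite -s0' ltxx in s0.
Qed.

End Descent.

(** * Measurable selections *)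

Lemma harmonic_lt {R : realType} (e : R) : 0 < e ->
  exists k : nat, k.+1%:R^-1 < e.
Proof.
move=> e0; have /cvgrPdist_lt/(_ e e0)[k _ hk] := @cvg_harmonic R.
exists k; have := hk k (leqnn k).
by rewrite /harmonic/= sub0r normrN ger0_norm.
Qed.

(** * Borel measurability in separable metric spaces *)

Section BorelMetric.
Context {R : realType} {X : completeMetricType R}.
Local Notation d := (@mdist R X).

Lemma separable_seq : separable X ->
  exists a : nat -> X, forall x r, 0 < r -> exists n, d x (a n) < r.
Proof.
move=> [A /countable_injP[f finj] dA].
(* Integers that index no point of [A] are sent to [point], which does no harm to density. *)
exists (fun n => xget point [set x | A x /\ f x = n]) => x r r0.
have [||y [xy Ay]] := dA (ball x r).
- by exists x; exact: ballxx.
- apply/open_mdistP => y; rewrite ballEmdist/= => xy.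
  exists (r - d x y); first by rewrite subr_gt0.
  by move=> z yz; have := metric_triangle x y z; lra.
exists (f y); case: xgetP => [z _ [Az fz]|/(_ y)/=]; last by case.
rewrite ballEmdist/= in xy.
by rewrite (finj z y _ _ fz) ?inE.
Qed.

Lemma borel_measurable_fun d' (T : measurableType d') (f : T -> X) :
  (forall O : set X, open O -> measurable (f @^-1` O)) ->
  measurable_fun setT (f : T -> borel X).
Proof.
move=> fO; apply: (@measurability _ _ _ (borel X) _ _ (@open X) erefl).
by move=> _ [U oU <-]; rewrite setTI; exact: fO.
Qed.

Lemma borel_open_preimage d' (T : measurableType d') (f : T -> borel X)
    (O : set X) :
  measurable_fun setT f -> open O -> measurable (f @^-1` O).
Proof.
move=> mf oO; rewrite -[X in measurable X]setTI; apply: mf => //.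
exact: sub_sigma_algebra.
Qed.

Lemma measurable_mdist_lt d' (T : measurableType d') (f : T -> borel X) a r :
  measurable_fun setT f -> measurable [set t | d (f t) a < r].
Proof.
move=> mf; apply: (borel_open_preimage (O := [set y | d y a < r]) mf).
apply/open_mdistP => y /= ya; exists (r - d y a); first by rewrite subr_gt0.
move=> z yz; have := metric_triangle z y a.
by rewrite (metric_sym z y); lra.
Qed.

Lemma continuous_borel_measurable (u : X -> R) : continuous u ->
  measurable_fun setT (u : borel X -> R).
Proof.
move=> /continuousP cu; apply: (measurability _ (RGenOpens.measurableE R)).
move=> _ [_ [a [b ->] <-]]; rewrite setTI; apply: sub_sigma_algebra.
exact/cu/interval_open.
Qed.

(* [f t \in O] iff, for some [k], the ball of radius [1 / k.+1] around [g n t]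
   is eventually contained in [O]. *)
Lemma borel_measurable_cvg d' (T : measurableType d') (g : nat -> T -> borel X)
    (f : T -> borel X) :
  (forall n, measurable_fun setT (g n)) ->
  (forall t, (g n t : X) @[n --> \oo] --> (f t : X)) ->
  measurable_fun setT f.
Proof.
move=> mg gf; apply: borel_measurable_fun => O oO.
pose E k := [set y : X | forall z, d y z < k.+1%:R^-1 -> O z].
have mE k n : measurable (g n @^-1` E k).
  (* The complement of [E k] is open: a point outside [O] at distance less than the radius stays so
     under a small move of the centre. *)
  rewrite -(setCK (E k)) -preimage_setC; apply: measurableC.
  apply: borel_open_preimage => //; apply/open_mdistP => y /=.
  move/existsNP => [z /not_implyP[yz nOz]].
  exists (k.+1%:R^-1 - d y z); first by rewrite subr_gt0.
  move=> w yw wE; apply: nOz; apply: wE; have := metric_triangle w y z.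
  by rewrite (metric_sym w y); set q := _^-1 in yw *; lra.
rewrite (_ : f @^-1` O = \bigcup_k \bigcup_N \bigcap_(n in [set n | (N <= n)%N])
    (g n @^-1` E k)).
  apply: bigcupT_measurable => k; apply: bigcupT_measurable => N.
  by apply: bigcap_measurable => //; exists N => /=.
apply/seteqP; split=> [t Oft|t [k _ [N _ EN]]].
- have [r r0 rO] := (iffLR (open_mdistP O) oO) (f t) Oft.
  have r2 : 0 < r / 2 by rewrite divr_gt0.
  have [k hk] := harmonic_lt r2.
  exists k => //.
  have [N _ hN] := metricType_numDomainType.cvgr_dist_lt (gf t) r2.
  exists N => // n /= Nn z gz; apply: rO.
  have := metric_triangle (f t) (g n t) z.
  have := hN n Nn; set q := _^-1 in gz hk *.
  by move=> /= *; lra.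
- have k0 : 0 < k.+1%:R^-1 :> R by rewrite invr_gt0.
  have [M _ hM] := metricType_numDomainType.cvgr_dist_lt (gf t) k0.
  apply: (EN (maxn N M)); first by rewrite /= leq_maxl.
  by rewrite metric_sym; apply: hM; rewrite /= leq_maxr.
Qed.

(** By separability an open subset of the product is a countable union of products of balls centred
    on a dense sequence, so measurability of each component suffices. *)
Lemma borel_measurable_pair_open d' (T : measurableType d') (f g : T -> borel X)
    (O : set (X * X)) :
  separable X -> measurable_fun setT f -> measurable_fun setT g ->
  open O -> measurable [set t | O (f t, g t)].
Proof.
move=> /separable_seq[a da] mf mg oO.
pose B (k i : nat) := [set y : X | d y (a i) < k.+1%:R^-1].
pose F (w : nat * nat * nat) : set T :=
  if `[< B w.1.1 w.1.2 `*` B w.1.1 w.2 `<=` O >]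
  then f @^-1` B w.1.1 w.1.2 `&` g @^-1` B w.1.1 w.2 else set0.
rewrite (_ : [set t | _] = \bigcup_w F w).
  apply: countable_bigcupT_measurable; first exact: countableP.
  move=> w; rewrite /F; case: ifP => // _.
  by apply: measurableI; exact: measurable_mdist_lt.
apply/seteqP; split=> [t Ofg|t [w _]]; last first.
  rewrite /F; case: ifP => [/asboolP wO [fw gw]|//]; exact: (wO (f t, g t)).
move: oO; rewrite openE => /(_ _ Ofg)[[U V]/= []].
move=> /nbhs_ballP[r /= r0 rU] /nbhs_ballP[s /= s0 sV] UVO.
have q0 : 0 < Num.min r s / 2 by rewrite divr_gt0// lt_min r0.
have [k kq] := harmonic_lt q0.
have k0 : 0 < k.+1%:R^-1 :> R by rewrite invr_gt0.
have [i fi] := da (f t) _ k0; have [j gj] := da (g t) _ k0.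
exists ((k, i), j) => //; rewrite /F ifT//=; apply/asboolP => -[y z] [/= By Bz].
have mr : Num.min r s <= r by rewrite ge_min lexx.
have ms : Num.min r s <= s by rewrite ge_min lexx orbT.
apply: UVO; split=> /=.
- apply: rU; rewrite ballEmdist/=; have := metric_triangle (f t) (a i) y.
  rewrite (metric_sym (a i)) => fy; apply: le_lt_trans fy _.
  by rewrite (lt_le_trans (ltrD fi By))//; apply: le_trans mr;
    set q := _^-1 in kq *; lra.
- apply: sV; rewrite ballEmdist/=; have := metric_triangle (g t) (a j) z.
  rewrite (metric_sym (a j)) => gz; apply: le_lt_trans gz _.
  by rewrite (lt_le_trans (ltrD gj Bz))//; apply: le_trans ms;
    set q := _^-1 in kq *; lra.
Qed.

End BorelMetric.

(** * The Kuratowski-Ryll-Nardzewski theorem *)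

Section Selection.
Context {R : realType} {X : completeMetricType R}.
Local Notation d := (@mdist R X).

Lemma half_expr_lt (e : R) : 0 < e -> exists n, 2^-1 ^+ n < e.
Proof.
move=> e0; have : 2^-1 ^+ n @[n --> \oo] --> (0 : R).
  by apply: cvg_expr; rewrite ger0_norm// invf_lt1// ltr1n.
move=> /cvgrPdist_lt/(_ e e0)[n _ hn]; exists n; have := hn n (leqnn n).
by rewrite /= sub0r normrN ger0_norm// exprn_ge0.
Qed.

(** The tube lemma: compactness of [K] makes the neighbourhoods of [w] that avoid [G] near each [y]
    uniform in [y]. *)
Lemma closed_projection (W : topologicalType) (G : set (W * X)) (K : set X) :
  closed G -> compact K -> closed [set w | exists2 y, K y & G (w, y)].
Proof.
move=> clG /compact_near_coveringP cK; rewrite -openC openE => w /= wG.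
have : \forall v \near w, K `<=` (fun y => ~ G (v, y)).
  apply: cK => y Ky; have : nbhs (w, y) (~` G).
    by apply: open_nbhs_nbhs; split; [exact/closed_openC|move=> ?; apply: wG;
      exists y].
  by case=> [[V U] [/= wV yU] VU]; exists (U, V) => // -[x v] [/= Ux Vv];
    exact: (VU (v, x)).
by apply: filterS => v Kv [y Ky]; exact: Kv.
Qed.

(** Taking the least admissible index keeps the choice measurable: its fibre over [i] is [A i] minus
    the earlier [A j]. *)
Lemma measurable_least d' (T : measurableType d') (A : nat -> set T) :
  (forall i, measurable (A i)) -> (forall t, exists i, A i t) ->
  exists N : T -> nat, (forall t, A (N t) t) /\
    forall i, measurable (N @^-1` [set i]).
Proof.
move=> mA exA; have exA' t : exists i, `[< A i t >].
  by have [i Ait] := exA t; exists i; exact/asboolP.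
exists (fun t => ex_minn (exA' t)); split=> [t|i].
  by case: ex_minnP => i /asboolP.
rewrite (_ : _ @^-1` _ = A i `\` \bigcup_(j in [set j | (j < i)%N]) A j).
  by apply: measurableD => //; apply: bigcup_measurable.
apply/seteqP; split=> t /=.
  case: ex_minnP => j /asboolP Aj jmin ji; rewrite -ji;
    split=> // -[k /= kj Ak].
  by have := jmin k (asboolT Ak); rewrite leqNgt kj.
case=> Ai iA; case: ex_minnP => j /asboolP Aj jmin.
apply/eqP; rewrite eqn_leq jmin ?andTb; last exact/asboolP.
by rewrite leqNgt; apply/negP => ji; apply: iA; exists j.
Qed.

Section KuratowskiRyllNardzewski.
Context {d' : measure_display} {T : measurableType d'} (P : T -> set X).
Hypothesis sX : separable X.
Hypothesis lX : locally_compact [set: X].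
Hypothesis clP : forall t, closed (P t).
Hypothesis P0 : forall t, P t !=set0.
Hypothesis mP : forall K, compact K ->
  measurable [set t | exists2 y, K y & P t y].

(** Local compactness and separability make [U] a countable union of compact balls, to which [mP]
    applies. *)
Let mPopen U : open U -> measurable [set t | exists2 y, U y & P t y].
Proof.
move=> oU; have [a da] := separable_seq sX.
pose B (w : nat * nat) := [set y : X | d (a w.1) y <= w.2.+1%:R^-1].
pose F w : set T := if `[< compact (B w) /\ B w `<=` U >]
  then [set t | exists2 y, B w y & P t y] else set0.
rewrite (_ : [set t | _] = \bigcup_w F w).
  apply: countable_bigcupT_measurable; first exact: countableP.
  by move=> w; rewrite /F; case: ifP => // /asboolP[+ _]; exact: mP.
apply/seteqP; split=> [t [y Uy Pty]|t [w _]]; last first.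
  by rewrite /F; case: ifP => [/asboolP[_ BU] [y /BU Uy Py]|//]; exists y.
have [r r0 rU] := (iffLR (open_mdistP U) oU) y Uy.
have [q q0 cK] := locally_compact_ball lX y.
have m0 : 0 < Num.min r q / 2 by rewrite divr_gt0// lt_min r0.
have [k hk] := harmonic_lt m0.
have k0 : 0 < k.+1%:R^-1 :> R by rewrite invr_gt0.
have [i yi] := da y _ k0.
have mr : Num.min r q <= r by rewrite ge_min lexx.
have mq : Num.min r q <= q by rewrite ge_min lexx orbT.
have By z : B (i, k) z -> d y z < Num.min r q.
  rewrite /B/=; have := metric_triangle y (a i) z.
  by move: yi hk; set s := _^-1 => yi hk yz az; lra.
exists (i, k) => //; rewrite /F ifT.
  by exists y => //; rewrite /B/= metric_sym ltW.
apply/asboolP; split; last first.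
  by move=> z /By yz; apply: rU; exact: lt_le_trans yz mr.
apply: (subclosed_compact _ cK); first exact: closed_ball_mdist.
by move=> z /By yz /=; apply: ltW; exact: lt_le_trans yz mq.
Qed.

(** Countably valued measurable maps [a (N n t)] are built so that [P t] meets the ball of radius
    [2^-n] around each and consecutive values are geometrically close. Their limit is measurable,
    and it lies in [P t] because [P t] is closed. *)
Lemma measurable_selection : exists f : T -> borel X,
  measurable_fun setT f /\ forall t, P t (f t).
Proof.
have [a da] := separable_seq sX.
have h0 n : 0 < (2^-1 : R) ^+ n by rewrite exprn_gt0.
have oB i n : open [set y | d (a i) y < 2^-1 ^+ n].
  apply/open_mdistP => y /= iy; exists (2^-1 ^+ n - d (a i) y).
    by rewrite subr_gt0.
  by move=> z yz; have := metric_triangle (a i) y z; lra.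
pose good n (N : T -> nat) := (forall i, measurable (N @^-1` [set i])) /\
  forall t, exists2 y, d (a (N t)) y < 2^-1 ^+ n & P t y.
pose close n (N N' : T -> nat) :=
  forall t, d (a (N t)) (a (N' t)) <= 2 * 2^-1 ^+ n.
have [N0 gN0] : exists N, good 0%N N.
  have [|t|N [PN mN]] := @measurable_least _ _
      (fun i => [set t | exists2 y, d (a i) y < 2^-1 ^+ 0 & P t y]).
  - by move=> i; exact: mPopen (oB i 0%N).
  - have [y Py] := P0 t; have [i yi] := da y _ (h0 0%N).
    by exists i, y => //; rewrite metric_sym.
  - by exists N.
have /choice[next nextP] (w : nat * (T -> nat)) : exists N', good w.1 w.2 ->
    good w.1.+1 N' /\ close w.1 w.2 N'.
  case: w => n N /=; have [gN|] := pselect (good n N); last by exists N.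
  have [mN PN] := gN.
  pose U j i := [set y | d (a j) y < 2^-1 ^+ n] `&`
                [set y | d (a i) y < 2^-1 ^+ n.+1].
  (* The new ball must meet [P t] inside the previous one; this keeps the two centres within
     [2 * 2^-n]. *)
  have [|t|N' [PN' mN']] := @measurable_least _ _
      (fun i => [set t | exists2 y, U (N t) i y & P t y]).
  (* Splitting on the value [j] of [N t] leaves a fixed open set for [mPopen]. *)
  - move=> i; rewrite (_ : [set t | _] =
        \bigcup_j (N @^-1` [set j] `&` [set t | exists2 y, U j i y & P t y])).
      apply: bigcupT_measurable => j; apply: measurableI => //.
      by apply: (mPopen (U := U j i)); exact: openI.
    apply/seteqP; split=> [t [y Uy Py]|t [j _ [<- ?]]//].
    by exists (N t) => //; split=> //; exists y.
  - have [y Ny Py] := PN t; have [i yi] := da y _ (h0 n.+1).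
    by exists i, y => //; split=> //=; rewrite metric_sym.
  exists N' => _; split.
    by split=> // t; have [y [_ N'y] Py] := PN' t; exists y.
  move=> t; have [y [/= Ny N'y] _] := PN' t.
  have := metric_triangle (a (N t)) y (a (N' t)).
  rewrite (metric_sym y); move: Ny N'y; rewrite exprS.
  by have := h0 n; lra.
pose N := fix N n := if n is m.+1 then next (m, N m) else N0.
have gN n : good n (N n).
  by elim: n => [|n IH] //=; exact: (nextP (n, N n) IH).1.
have cN n : close n (N n) (N n.+1) by exact: (nextP (n, N n) (gN n)).2.
have /choice[f fP] t : exists l : X, (a (N n t) @[n --> \oo] --> l) /\
    forall n, d (a (N n t)) l <= 2 * 2 * 2^-1 ^+ n.
  have [|l zl lb] := @mdist_geometric_cvg _ _ (fun n => a (N n t)) 2.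
    by move=> n; exact: cN.
  by exists l.
exists f; split.
  apply: (@borel_measurable_cvg _ _ _ _ (fun n t => a (N n t))) => [n|t].
    apply: borel_measurable_fun => O _.
    rewrite (_ : _ @^-1` O = \bigcup_(j in [set j | O (a j)]) (N n @^-1` [set
      j])).
      by apply: bigcup_measurable => j _; exact: (gN n).1.
    by apply/seteqP; split=> [t Ot|t [j + jt]];
      [by exists (N n t)|by rewrite -jt].
  exact: (fP t).1.
move=> t; apply: contrapT => nPf.
have /open_mdistP/(_ (f t) nPf)[r r0 rP] : open (~` P t) by exact: closed_openC.
(* From [f t] to the centre at most [4 * 2^-n], from there to a point of [P t] less than [2^-n]:
   five in all. *)
have [n hn] := half_expr_lt (divr_gt0 r0 (ltr0n R 5)).
have [y Ny Py] := (gN n).2 t; apply: (rP y) => //.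
have := metric_triangle (f t) (a (N n t)) y; have := (fP t).2 n.
by rewrite (metric_sym (f t) (a _)); lra.
Qed.

End KuratowskiRyllNardzewski.

(** The parameters whose section meets a compact [K] form the preimage under [(f, g)] of a set that
    is closed by [closed_projection]. *)
Lemma closed_relation_selection d' (T : measurableType d') (f g : T -> borel X)
    (G : set (X * X * X)) :
  separable X -> locally_compact [set: X] ->
  measurable_fun setT f -> measurable_fun setT g -> closed G ->
  (forall t, exists y, G (f t, g t, y)) ->
  exists h : T -> borel X, measurable_fun setT h /\
    forall t, G (f t, g t, h t).
Proof.
move=> sX lX mf mg clG exG.
apply: (measurable_selection (P := fun t => [set y | G (f t, g t, y)])) => //.
  move=> t; apply: (@preimage_closed _ _ (pair (f t : X, g t : X)) G) => // y _.
  exact: (cvg_pair (cvg_cst (f t : X, g t : X)) cvg_id).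
move=> K cK; rewrite -[X in measurable X]setCK; apply: measurableC.
apply: (borel_measurable_pair_open (O :=
  ~` [set w | exists2 y, K y & G (w, y)])) => //.
by apply: closed_openC; exact: closed_projection.
Qed.

End Selection.

(** * Gradient rays *)

Section GradientRays.
Context {R : realType} {X : completeMetricType R}.
Local Notation d := (@mdist R X).
Variable u : X -> R.
Hypothesis sX : separable X.
Hypothesis lX : locally_compact [set: X].
Hypothesis gX : geodesic_space d.
Hypothesis ulip : forall x y, `|u x - u y| <= d x y.
Hypothesis su : forall y, (1 <= descending_slope d u y)%E.

Let le_sub y z : u y - u z <= d y z.
Proof. exact: le_trans (ler_norm _) (ulip y z). Qed.

Let continuous_mdist (W : topologicalType) (f g : W -> X) :
  continuous f -> continuous g -> continuous (fun w => d (f w) (g w)).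
Proof. by move=> cf cg w; apply: cvg_mdist; [exact: cf|exact: cg]. Qed.

Let closed_eq_fun (W : topologicalType) (f g : W -> R) :
  continuous f -> continuous g -> closed [set w | f w = g w].
Proof.
move=> cf cg; rewrite (_ : [set w | _] = (fun w => f w - g w) @^-1` [set 0]).
  apply: preimage_closed; last exact: closed_eq.
  by move=> w _; apply: cvgB; [exact: cf|exact: cg].
by apply/seteqP; split=> w /=; [move=> ->; exact: subrr|exact: subr0_eq].
Qed.

Let c11 : continuous (fun w : X * X * X => w.1.1).
Proof. by move=> w; apply: (cvg_comp _ _ cvg_fst); exact: cvg_fst. Qed.

Let c12 : continuous (fun w : X * X * X => w.1.2).
Proof. by move=> w; apply: (cvg_comp _ _ cvg_fst); exact: cvg_snd. Qed.

Let c2 : continuous (fun w : X * X * X => w.2).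
Proof. by move=> w; exact: cvg_snd. Qed.

Lemma unit_descent_selection : exists F : borel X -> borel X,
  measurable_fun setT F /\ forall x, d x (F x) = 1 /\ u x - u (F x) = 1.
Proof.
have cu := lipschitz_continuous ulip.
pose G := [set w : X * X * X | d w.1.1 w.2 = 1] `&`
          [set w : X * X * X | u w.1.1 - u w.2 = 1].
have clG : closed G.
  apply: closedI; apply: closed_eq_fun; try exact: cst_continuous.
    exact: continuous_mdist.
  have cuf (f : X * X * X -> X) : continuous f -> continuous (u \o f).
    by move=> cf w; apply: continuous_comp; [exact: cf|exact: cu].
  by move=> w; apply: cvgB; [exact: (cuf _ c11)|exact: (cuf _ c2)].
have mid : measurable_fun setT (id : borel X -> borel X)
  by exact: measurable_id.
apply: (closed_relation_selection sX lX mid mid clG) => x.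
exact: descent_exists.
Qed.

Lemma midpoint_selection d' (T : measurableType d') (f g : T -> borel X) :
  measurable_fun setT f -> measurable_fun setT g ->
  exists h : T -> borel X, measurable_fun setT h /\
    forall t, d (f t) (h t) = d (f t) (g t) / 2 /\
              d (h t) (g t) = d (f t) (g t) / 2.
Proof.
move=> mf mg.
pose G := [set w : X * X * X | d w.1.1 w.2 = d w.1.1 w.1.2 / 2] `&`
          [set w : X * X * X | d w.2 w.1.2 = d w.1.1 w.1.2 / 2].
have c : continuous (fun w : X * X * X => d w.1.1 w.1.2 / 2).
  by move=> w; apply: cvgM; [exact: (continuous_mdist c11 c12)|exact: cvg_cst].
have clG : closed G.
  by apply: closedI; apply: closed_eq_fun => //; exact: continuous_mdist.
apply: (closed_relation_selection sX lX mf mg clG) => t.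
exact: geodesic_midpoint.
Qed.

(** A discrete gradient flow: [f k x] stands for the position at time [k * c] on a ray from [x]. *)
Definition descent_sequence (f : nat -> borel X -> borel X) (c : R) :=
  [/\ forall k, measurable_fun setT (f k), f 0%N = id
    & forall k x, d (f k x) (f k.+1 x) = c /\ u (f k x) - u (f k.+1 x) = c].

(** Midpoints are inserted at odd indices. On each half [u] drops by at most [c / 2] and on both by
    [c], so each drop is exactly [c / 2]. *)
Lemma descent_sequence_refine f c : descent_sequence f c ->
  exists f', descent_sequence f' (c / 2) /\ forall k, f' k.*2 = f k.
Proof.
move=> [mf f0 fc].
have /choice[h hP] k := midpoint_selection (mf k) (mf k.+1).
pose f' k := if odd k then h k./2 else f k./2.
exists f'; split; last by move=> k; rewrite /f' odd_double doubleK.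
split=> [k||k x]; first by rewrite /f'; case: ifP => // _; exact: (hP _).1.
  by rewrite /f'.
have [fd fu] := fc k./2 x; have [h1 h2] := (hP k./2).2 x.
have u1 := le_sub (f k./2 x) (h k./2 x).
have u2 := le_sub (h k./2 x) (f k./2.+1 x).
rewrite fd in h1 h2; rewrite /f' /= uphalf_half.
by case: (odd k) => /=; rewrite ?add1n ?add0n; split=> //; lra.
Qed.

Lemma descent_sequence_sub f c : descent_sequence f c ->
  forall k x, u x - u (f k x) = k%:R * c.
Proof.
move=> [_ f0 fc]; elim=> [|k IH] x; first by rewrite f0 subrr mul0r.
by rewrite -natr1 mulrDl mul1r -(IH x); have := (fc k x).2; lra.
Qed.

Lemma descent_sequence_mdist f c : descent_sequence f c ->
  forall k j x, d (f k x) (f (k + j)%N x) <= j%:R * c.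
Proof.
move=> [_ _ fc] k; elim=> [|j IH] x; first by rewrite addn0 mdistxx mul0r.
rewrite addnS -natr1 mulrDl mul1r.
apply: (le_trans (metric_triangle _ (f (k + j)%N x) _)).
by rewrite lerD// (fc _ _).1.
Qed.

(** Compatible flows on the dyadic grids of mesh [2^-n], the unit one being the iteration of the
    selected descent map. *)
Lemma descent_sequences : exists D : nat -> nat -> borel X -> borel X,
  (forall n, descent_sequence (D n) (2^-1 ^+ n)) /\
  forall n k, D n.+1 k.*2 = D n k.
Proof.
have [F [mF PF]] := unit_descent_selection.
have D0 : descent_sequence (fun k => iter k F) (2^-1 ^+ 0).
  split=> //; elim=> [|k IH]; first exact: measurable_id.
  exact: measurableT_comp mF IH.
have /choice[next nextP] (w : nat * (nat -> borel X -> borel X)) : exists f',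
    descent_sequence w.2 (2^-1 ^+ w.1) ->
    descent_sequence f' (2^-1 ^+ w.1.+1) /\ forall k, f' k.*2 = w.2 k.
  case: w => n f /=; have [df|] := pselect (descent_sequence f (2^-1 ^+ n)).
    by have [f' f'P] := descent_sequence_refine df; exists f'; rewrite exprSr.
  by exists f.
pose D := fix D n := if n is m.+1 then next (m, D m) else fun k => iter k F.
have DP n : descent_sequence (D n) (2^-1 ^+ n).
  by elim: n => [//|n IH]; exact: (nextP (n, D n) IH).1.
by exists D; split=> // n; exact: (nextP (n, D n) (DP n)).2.
Qed.

Let half_exprK n : (2^-1 : R) ^+ n * 2 ^+ n = 1.
Proof. by rewrite -exprMn mulVf// expr1n. Qed.

(** The dyadic approximations of [t] at levels [n] and [n.+1] differ by at most one step of the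
    finer grid. For negative [t] both truncations are [0]. *)
Lemma truncn_double (t : R) n : exists b : bool,
  Num.truncn (t * 2 ^+ n.+1) = ((Num.truncn (t * 2 ^+ n)).*2 + b)%N.
Proof.
have [t0|t0] := ltP t 0.
  have trunc0 k : Num.truncn (t * 2 ^+ k) = 0%N.
    apply/truncn0Pn; rewrite -ltNge; apply: lt_trans ltr01.
    by rewrite pmulr_llt0// exprn_gt0.
  by exists false; rewrite !trunc0.
set m := Num.truncn (t * 2 ^+ n); set M := Num.truncn (t * 2 ^+ n.+1).
have /truncn_itv/andP[m1 m2] : 0 <= t * 2 ^+ n by rewrite mulr_ge0// exprn_ge0.
have /truncn_itv/andP[M1 M2] : 0 <= t * 2 ^+ n.+1.
  by rewrite mulr_ge0// exprn_ge0.
rewrite -/m -/M in m1 m2 M1 M2; rewrite exprSr mulrA in M1 M2.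
have mM : (m.*2 < M.+1)%N.
  rewrite -(ltr_nat R); apply: le_lt_trans M2.
  by rewrite -muln2 natrM ler_pM2r.
have Mm : (M < m.+1.*2)%N.
  rewrite -(ltr_nat R); apply: le_lt_trans M1 _.
  by rewrite -muln2 natrM ltr_pM2r.
exists (M != m.*2); have [->|] := eqVneq M m.*2; first by rewrite addn0.
rewrite doubleS in Mm; move=> /eqP; lia.
Qed.

(** [gamma t x] is the limit of the positions at the dyadic approximations of [t], which converge
    geometrically by [truncn_double]. Distances are at most [t - s] as limits of discrete paths, and
    at least that because [u] drops by [t - s]. *)
Lemma gradient_rays : exists gamma : R -> borel X -> borel X,
  [/\ forall t, measurable_fun setT (gamma t), gamma 0 = id,
      forall s t x, 0 <= s -> 0 <= t -> d (gamma s x) (gamma t x) = `|s - t|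
    & forall t x, 0 <= t -> u x - u (gamma t x) = t].
Proof.
have [D [DP DD]] := descent_sequences.
pose m n t := Num.truncn (t * 2 ^+ n : R).
have h0 n : 0 < (2^-1 : R) ^+ n by rewrite exprn_gt0.
have zS t x n : d (D n (m n t) x) (D n.+1 (m n.+1 t) x) <= 1 * 2^-1 ^+ n.
  have [b mb] := truncn_double t n; rewrite /m mb -DD.
  apply: (le_trans (descent_sequence_mdist (DP n.+1) _ _ _)).
  by rewrite exprS; have := h0 n; case: b {mb} => /=; lra.
have /choice[g gP] (w : R * X) : exists l : X,
    (D n (m n w.1) w.2 @[n --> \oo] --> l) /\
    forall n, d (D n (m n w.1) w.2) l <= 2 * 2^-1 ^+ n.
  have [|l zl lb] := @mdist_geometric_cvg _ _ (fun n => D n (m n w.1) w.2) 1.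
    by move=> n; exact: zS.
  by exists l; split=> // n; have := lb n; rewrite mulr1.
have mP n t : 0 <= t ->
    (m n t)%:R * 2^-1 ^+ n <= t /\ t < ((m n t)%:R + 1) * 2^-1 ^+ n.
  move=> t0; have /truncn_itv/andP[m1 m2] : 0 <= t * 2 ^+ n.
    by rewrite mulr_ge0// exprn_ge0.
  have tE : t = t * 2 ^+ n * 2^-1 ^+ n.
    by rewrite -mulrA (mulrC (2 ^+ n)) half_exprK mulr1.
  split; first by rewrite [leRHS]tE ler_pM2r.
  by rewrite [ltLHS]tE ltr_pM2r// (natr1 (m n t)).
have gu t x : 0 <= t -> u x - u (g (t, x)) = t.
  move=> t0; apply/eqP; rewrite -subr_eq0 -normr_le0;
    apply/ler_addgt0Pl => e e0.
  (* Errors in units of [2^-n]: two for the passage to the limit, one for rounding [t]. *)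
  have [n hn] := half_expr_lt (divr_gt0 e0 (ltr0n R 3)).
  have [_ /(_ n)/= gn] := gP (t, x); have [m1 m2] := mP n t t0.
  have := descent_sequence_sub (DP n) (m n t) x.
  have := le_trans (ulip _ _) gn; rewrite ler_norml => /andP[].
  rewrite mulrDl mul1r in m2; rewrite addr0 ler_norml => *.
  by apply/andP; split; lra.
have gle s t x : 0 <= s -> s <= t -> d (g (s, x)) (g (t, x)) <= t - s.
  move=> s0 st; have t0 := le_trans s0 st; apply/ler_addgt0Pl => e e0.
  (* Two units for each of the two limits and one for rounding. *)
  have [n hn] := half_expr_lt (divr_gt0 e0 (ltr0n R 5)).
  have [_ /(_ n)/= gs] := gP (s, x); have [_ /(_ n)/= gt] := gP (t, x).
  have mst : (m n s <= m n t)%N by apply: le_truncn;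
    rewrite ler_pM2r// exprn_gt0.
  have := descent_sequence_mdist (DP n) (m n s) (m n t - m n s) x.
  rewrite subnKC// natrB// mulrBl => Dst.
  have [s1 s2] := mP n s s0; have [t1 t2] := mP n t t0.
  rewrite mulrDl mul1r in s2 t2.
  have := metric_triangle (g (s, x)) (D n (m n s) x) (g (t, x)).
  have := metric_triangle (D n (m n s) x) (D n (m n t) x) (g (t, x)).
  by rewrite metric_sym in gs; lra.
have gE s t x : 0 <= s -> s <= t -> d (g (s, x)) (g (t, x)) = t - s.
  move=> s0 st; apply/le_anti; rewrite gle//=.
  have := le_sub (g (s, x)) (g (t, x)).
  by have := gu s x s0; have := gu t x (le_trans s0 st); lra.
exists (fun t x => g (t, x)); split=> [t||s t x s0 t0|].
- apply: (@borel_measurable_cvg _ _ _ _ (fun n => D n (m n t))) => [n|x].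
    by have [] := DP n.
  exact: (gP (t, x)).1.
- apply/funext => x; apply: (@mdist_positivity R X).
  apply/le_anti; rewrite mdist_ge0 andbT; apply/ler_addgt0Pl => e e0.
  have [n hn] := half_expr_lt (divr_gt0 e0 (ltr0n R 2)).
  have [_ /(_ n)/=] := gP (0, x); rewrite /m mul0r truncn0.
  by have [_ -> _] := DP n; rewrite metric_sym /=; lra.
- have [st|/ltW ts] := leP s t;
  first by rewrite gE// distrC ger0_norm// subr_ge0.
  by rewrite metric_sym gE// ger0_norm// subr_ge0.
- exact: gu.
Qed.

End GradientRays.

(** * Wasserstein space *)

Section Moments.
Context {d : measure_display} {T : measurableType d} {R : realType}.
Variables (P : probability T R) (p : R).
Hypothesis p1 : 1 <= p.

Let p0 : 0 < p. Proof. exact: lt_le_trans ltr01 p1. Qed.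

Let PT : (P : {measure set T -> \bar R}) setT = 1%E.
Proof. exact: probability_setT. Qed.

Let measurable_powR_comp (f : T -> R) :
  measurable_fun setT f -> measurable_fun setT (fun x => (f x `^ p)%:E).
Proof.
move=> mf; apply/measurable_EFinP.
exact: (measurableT_comp (measurable_powR p) mf).
Qed.

(** Hölder's inequality against the constant [1], of norm [1] for a probability. The case [p = 1],
    with no finite conjugate exponent, is immediate. *)
Lemma mean_le_moment (f : T -> R) :
  measurable_fun setT f -> (forall x, 0 <= f x) ->
  (\int[P]_x (f x)%:E <= (\int[P]_x (f x `^ p)%:E) `^ p^-1)%E.
Proof.
move=> mf f0.
have [->|pN1] := eqVneq p 1.
  rewrite invr1 poweRe1; last by apply: integral_ge0 => x _;
    rewrite lee_fin powR_ge0.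
  by under [leRHS]eq_integral do rewrite powRr1//.
have p1' : 1 < p by rewrite lt_neqAle eq_sym pN1.
pose q := p / (p - 1).
have q0 : 0 < q by rewrite divr_gt0// subr_gt0.
have pq1 : p^-1 + q^-1 = 1.
  by rewrite /q invf_div -{1}(div1r p) -mulrDl subrKC mulfV// gt_eqF.
have := hoelder P mf (@measurable_cst _ _ _ _ setT (1 : R)) p0 q0 pq1.
have -> : (EFin \o cst (1 : R)) = cst 1%E :> (T -> \bar R) by [].
rewrite Lnorm_cst1 PT poweR1r mule1 Lnorm1.
rewrite unlock.
under eq_integral do rewrite /= mulr1 ger0_norm//.
by under [in leRHS]eq_integral do rewrite /= ger0_norm//.
Qed.

(** A form of Jensen's inequality that allows an infinite moment, where nothing is to be shown. *)
Lemma powR_mean_le_moment (f : T -> R) a :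
  measurable_fun setT f -> (forall x, 0 <= f x) -> 0 <= a ->
  (a%:E <= \int[P]_x (f x)%:E)%E ->
  ((a `^ p)%:E <= \int[P]_x (f x `^ p)%:E)%E.
Proof.
move=> mf f0 a0 /le_trans/(_ (mean_le_moment mf f0)).
have : (0 <= \int[P]_x (f x `^ p)%:E)%E.
  by apply: integral_ge0 => x _; rewrite lee_fin powR_ge0.
case: (\int[P]_x _)%E => [r r0|_ _|//]; last by rewrite leey.
rewrite poweR_EFin !lee_fin => ar.
have -> : r = (r `^ p^-1) `^ p by rewrite -powRrM mulVf ?gt_eqF// powRr1.
by apply: ge0_ler_powR; rewrite ?nnegrE ?powR_ge0// ltW.
Qed.

Lemma mean_lty (f : T -> R) :
  measurable_fun setT f -> (forall x, 0 <= f x) ->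
  (\int[P]_x (f x `^ p)%:E < +oo)%E -> (\int[P]_x (f x)%:E < +oo)%E.
Proof.
move=> mf f0; have : (0 <= \int[P]_x (f x `^ p)%:E)%E.
  by apply: integral_ge0 => x _; rewrite lee_fin powR_ge0.
move=> I0 Ioo; apply: le_lt_trans (mean_le_moment mf f0) _.
move: I0 Ioo; case: (\int[P]_x _)%E => [r _ _|//|//].
by rewrite poweR_EFin ltry.
Qed.

Lemma moment_ltyD (f g h : T -> R) :
  measurable_fun setT f -> measurable_fun setT g -> measurable_fun setT h ->
  (forall x, 0 <= f x) -> (forall x, 0 <= g x) ->
  (forall x, 0 <= h x <= f x + g x) ->
  (\int[P]_x (f x `^ p)%:E < +oo)%E -> (\int[P]_x (g x `^ p)%:E < +oo)%E ->
  (\int[P]_x (h x `^ p)%:E < +oo)%E.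
Proof.
move=> mf mg mh f0 g0 hfg foo goo.
have p0' := ltW p0.
(* A sum is at most twice the larger of its terms. *)
have hle x : h x `^ p <= 2 `^ p * (f x `^ p) + 2 `^ p * (g x `^ p).
  have /andP[h0 hx] := hfg x; rewrite -!powRM//.
  have [fg|/ltW gf] := leP (f x) (g x).
    apply: (@le_trans _ _ ((2 * g x) `^ p)); last by rewrite lerDr powR_ge0.
    by apply: ge0_ler_powR; rewrite ?nnegrE ?mulr_ge0//; lra.
  apply: (@le_trans _ _ ((2 * f x) `^ p)); last by rewrite lerDl powR_ge0.
  by apply: ge0_ler_powR; rewrite ?nnegrE ?mulr_ge0//; lra.
apply: (@le_lt_trans _ _ (\int[P]_x ((2 `^ p)%:E * (f x `^ p)%:E +
                                   (2 `^ p)%:E * (g x `^ p)%:E))%E).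
  apply: ge0_le_integral => //.
  - by move=> x _; rewrite lee_fin powR_ge0.
  - exact: measurable_powR_comp.
  - by apply: emeasurable_funD; apply: measurable_funeM;
    exact: measurable_powR_comp.
  - by move=> x _; rewrite -!EFinM -EFinD lee_fin.
rewrite ge0_integralD//.
- rewrite !ge0_integralZl//; try exact: measurable_powR_comp;
  try by move=> x _; rewrite lee_fin powR_ge0.
  by apply: lte_add_pinfty; apply: lte_mul_pinfty => //;
    rewrite lee_fin powR_ge0.
- by move=> x _; rewrite -EFinM lee_fin mulr_ge0// powR_ge0.
- by apply: measurable_funeM; exact: measurable_powR_comp.
- by move=> x _; rewrite -EFinM lee_fin mulr_ge0// powR_ge0.
- by apply: measurable_funeM; exact: measurable_powR_comp.
Qed.

Lemma moment_cst_lty c : (\int[P]_x (c `^ p)%:E < +oo)%E.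
Proof. by rewrite integral_cst// PT mule1 ltry. Qed.

End Moments.

(** * Laws, couplings and bounds on the Wasserstein distance *)

Section WassersteinSpace.
Context {R : realType} {X : completeMetricType R} (p : R).
Local Notation d := (@mdist R X).
Local Notation W := (wasserstein_dist X p).
Hypothesis sX : separable X.
Hypothesis p1 : 1 <= p.

Let p0 : 0 < p. Proof. exact: lt_le_trans ltr01 p1. Qed.

Let mreal (u : X -> R) : continuous u -> measurable_fun setT (u : borel X -> R).
Proof. exact: continuous_borel_measurable. Qed.

Let mdistl (x0 : X) : measurable_fun setT (fun x : borel X => d x x0).
Proof.
by apply: mreal => x; apply: cvg_mdist; [exact: cvg_id|exact: cvg_cst].
Qed.

Lemma measurable_mdist d' (T : measurableType d') (f g : T -> borel X) :
  measurable_fun setT f -> measurable_fun setT g ->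
  measurable_fun setT (fun t => d (f t) (g t)).
Proof.
move=> mf mg; apply: (measurability _ (RGenOpens.measurableE R)).
move=> _ [_ [a [b ->] <-]]; rewrite setTI.
apply: (borel_measurable_pair_open (O :=
  (fun w => d w.1 w.2) @^-1` `]a, b[%classic)) => //.
have /continuousP : continuous (fun w : X * X => d w.1 w.2).
  by move=> w; apply: cvg_mdist; [exact: cvg_fst|exact: cvg_snd].
by apply; exact: interval_open.
Qed.

Let measurable_powR_EFin d' (T : measurableType d') (f : T -> R) :
  measurable_fun setT f -> measurable_fun setT (fun x => (f x `^ p)%:E).
Proof.
move=> mf; apply/measurable_EFinP.
exact: (measurableT_comp (measurable_powR p) mf).
Qed.

(** By the triangle inequality, moving the base point costs only the constant [d x0 x1]. *)
Lemma finite_momentP (w : probability (borel X) R) (x1 : X) :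
  finite_moment p w -> (\int[w]_x (d x x1 `^ p)%:E < +oo)%E.
Proof.
move=> [x0 hx0].
apply: (@moment_ltyD _ _ _ w p p1 (fun x => d x x0) (fun=> d x0 x1)) => //.
- by move=> x; exact: mdist_ge0.
- by move=> x; exact: mdist_ge0.
- by move=> x; rewrite mdist_ge0 metric_triangle.
- exact: moment_cst_lty.
Qed.

(* The law of [f] under [w] is described through its values on measurable sets
   rather than as a pushforward, so that [w] itself is the law of [id]. *)
Definition is_law d' (T : measurableType d') (w : probability T R)
    (f : T -> borel X) (mu : probability (borel X) R) :=
  measurable_fun setT f /\
  forall A, measurable A -> mu A = w (f @^-1` A).

Lemma is_law_exists d' (T : measurableType d') (w : probability T R)
    (f : T -> borel X) :
  measurable_fun setT f -> exists mu, is_law w f mu.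
Proof.
move=> mf; pose F : {mfun T >-> borel X} :=
  HB.pack f (isMeasurableFun.Build _ _ _ _ f mf).
by exists [the probability (borel X) R of distribution w F].
Qed.

Lemma is_law_id (w : probability (borel X) R) : is_law w id w.
Proof. by split=> //; exact: measurable_id. Qed.

Lemma ge0_integral_law d' (T : measurableType d') (w : probability T R)
    (f : T -> borel X) mu (g : borel X -> \bar R) :
  is_law w f mu -> measurable_fun setT g -> (forall x, 0 <= g x)%E ->
  (\int[mu]_x g x = \int[w]_t g (f t))%E.
Proof.
move=> [mf muE] mg g0; rewrite (eq_measure_integral (pushforward w f)).
  by rewrite ge0_integral_pushforward.
by move=> A mA _; exact: muE.
Qed.

Lemma integrable_law d' (T : measurableType d') (w : probability T R)
    (f : T -> borel X) mu (g : borel X -> \bar R) :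
  is_law w f mu -> mu.-integrable setT g -> w.-integrable setT (g \o f).
Proof.
move=> /[dup] muE [mf _] /integrableP[mg goo]; apply/integrableP; split.
  exact: measurableT_comp mg mf.
rewrite (ge0_integral_law muE) in goo => //.
exact: measurableT_comp mg.
Qed.

Lemma Rintegral_law d' (T : measurableType d') (w : probability T R)
    (f : T -> borel X) mu (g : borel X -> R) :
  is_law w f mu -> mu.-integrable setT (EFin \o g) ->
  \int[mu]_x g x = \int[w]_t g (f t).
Proof.
move=> /[dup] muE [mf muP] ig; congr fine.
rewrite (eq_measure_integral (pushforward w f)); last first.
  by move=> A mA _; exact: muP.
rewrite integral_pushforward//; first by case/integrableP: ig.
exact: (integrable_law muE ig).
Qed.

Lemma couplingP (pi : probability (borel X * borel X)%type R) mu nu :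
  couplings mu nu pi <-> is_law pi fst mu /\ is_law pi snd nu.
Proof.
split=> [pimn|[[_ h1] [_ h2]] A mA].
  split; split=> [|A mA]; [exact: measurable_fst| |exact: measurable_snd|].
    by rewrite -(pimn A mA).1 -[in RHS]setXT//; congr (pi _); apply/seteqP;
      split=> [[]|[]] //= ? ? [].
  by rewrite -(pimn A mA).2; congr (pi _); apply/seteqP;
    split=> [[]|[]] //= ? ? [].
rewrite h1// h2//; split; congr (pi _); apply/seteqP; split=> -[a b]//=;
  by case.
Qed.

Lemma moment_law d' (T : measurableType d') (w : probability T R)
    (f : T -> borel X) (mu : probability (borel X) R) (x0 : X) :
  is_law w f mu ->
  (\int[mu]_x (d x x0 `^ p)%:E = \int[w]_t (d (f t) x0 `^ p)%:E)%E.
Proof.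
move=> muE; rewrite (ge0_integral_law muE)//.
- exact: measurable_powR_EFin.
- by move=> x; rewrite lee_fin powR_ge0.
Qed.

Lemma finite_moment_law (w : wasserstein_space X p) (f : borel X -> borel X) c :
  measurable_fun setT f -> (forall x, d (f x) x <= c) ->
  exists mu : wasserstein_space X p, is_law (sval w) f (sval mu).
Proof.
move=> mf fc; have [mu muE] := is_law_exists (sval w) mf.
suff mum : finite_moment p mu by exists (exist _ mu mum).
exists point; rewrite (moment_law _ muE).
apply: (@moment_ltyD _ _ _ (sval w) p p1 (fun x => d x point) (fun=> c)) => //.
- by apply: measurable_mdist => //; exact: measurable_cst.
- by move=> x; exact: mdist_ge0.
- by move=> x; exact: le_trans (mdist_ge0 _ _) (fc x).
- move=> x; rewrite mdist_ge0/= addrC.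
  by apply: (le_trans (metric_triangle _ x _)); rewrite lerD2r.
- exact: finite_momentP (svalP w).
- exact: moment_cst_lty.
Qed.

Definition transport_costs (mu nu : probability (borel X) R) : set (\bar R) :=
  [set (\int[pi]_z ((d (z.1 : X) z.2) `^ p)%:E)%E | pi in couplings mu nu].

Lemma transport_cost_ge0 mu nu c : transport_costs mu nu c -> (0 <= c)%E.
Proof.
by move=> [pi _ <-]; apply: integral_ge0 => z _; rewrite lee_fin powR_ge0.
Qed.

(** The product measure is a coupling of finite cost. Hence [fine] loses nothing in
    [wasserstein_dist]. *)
Lemma wasserstein_inf_fin_num (mu nu : wasserstein_space X p) :
  ereal_inf (transport_costs (sval mu) (sval nu)) \is a fin_num.
Proof.
rewrite ge0_fin_numE; last first.
  by apply: le_ereal_inf_tmp => c; exact: transport_cost_ge0.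
pose pi := [the probability (borel X * borel X)%type R of
  (sval mu \x sval nu)%E].
have piC : couplings (sval mu) (sval nu) pi.
  move=> A mA; rewrite /pi/= !product_measure1E//; split.
    by rewrite [X in (_ * X)%E](probability_setT (sval nu)) mule1.
  by rewrite [X in (X * _)%E](probability_setT (sval mu)) mul1e.
apply: le_lt_trans (ereal_inf_lbound _) _; first by exists pi.
have /couplingP[l1 l2] := piC.
apply: (@moment_ltyD _ _ _ pi p p1 (fun z => d z.1 point)
  (fun z => d z.2 point)).
- by apply: measurable_mdist; [exact: measurable_fst|exact: measurable_cst].
- by apply: measurable_mdist; [exact: measurable_snd|exact: measurable_cst].
- by apply: measurable_mdist; [exact: measurable_fst|exact: measurable_snd].
- by move=> z; exact: mdist_ge0.
- by move=> z; exact: mdist_ge0.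
- by move=> z; rewrite mdist_ge0/= (metric_sym z.2) metric_triangle.
- by rewrite -(moment_law _ l1); exact: finite_momentP (svalP mu).
- by rewrite -(moment_law _ l2); exact: finite_momentP (svalP nu).
Qed.

Lemma wasserstein_dist_ge (mu nu : wasserstein_space X p) a : 0 <= a ->
  (forall pi, couplings (sval mu) (sval nu) pi ->
    ((a `^ p)%:E <= \int[pi]_z (d (z.1 : X) z.2 `^ p)%:E)%E) ->
  a <= W mu nu.
Proof.
move=> a0 ha; rewrite /wasserstein_dist -/(transport_costs _ _).
have /fineK := wasserstein_inf_fin_num mu nu.
have : ((a `^ p)%:E <= ereal_inf (transport_costs (sval mu) (sval nu)))%E.
  by apply: le_ereal_inf_tmp => _ [pi piC <-]; exact: ha.
move=> /[swap] <-; rewrite lee_fin => api.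
have -> : a = (a `^ p) `^ p^-1 by rewrite -powRrM mulfV ?gt_eqF// powRr1.
apply: ge0_ler_powR; rewrite ?nnegrE ?invr_ge0 ?powR_ge0 ?(ltW p0)//.
exact: le_trans (powR_ge0 _ _) api.
Qed.

(** The joint law of [(f, g)] is a coupling of cost at most [c] to the power [p]. *)
Lemma wasserstein_dist_law_le d' (T : measurableType d') (w : probability T R)
    (f g : T -> borel X) (mu nu : wasserstein_space X p) c :
  is_law w f (sval mu) -> is_law w g (sval nu) -> 0 <= c ->
  (forall t, d (f t) (g t) <= c) -> W mu nu <= c.
Proof.
move=> [mf muE] [mg nuE] c0 fgc.
rewrite /wasserstein_dist -/(transport_costs _ _).
have mfg : measurable_fun setT (fun t => (f t, g t)).
  exact: measurable_fun_pair.
pose F : {mfun T >-> (borel X * borel X)%type} :=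
  HB.pack (fun t => (f t, g t)) (isMeasurableFun.Build _ _ _ _ _ mfg).
pose pi := [the probability (borel X * borel X)%type R of distribution w F].
have piC : couplings (sval mu) (sval nu) pi.
  move=> A mA; rewrite muE// nuE//; split.
    by congr (w _); apply/seteqP; split=> t //= [].
  by congr (w _); apply/seteqP; split=> t //= [].
have : (ereal_inf (transport_costs (sval mu) (sval nu)) <= (c `^ p)%:E)%E.
  apply: (@le_trans _ _ (\int[pi]_z (d (z.1 : X) z.2 `^ p)%:E)%E).
    by apply: ereal_inf_lbound; exists pi.
  rewrite ge0_integral_distribution.
  - apply: (@le_trans _ _ (\int[w]_t (c `^ p)%:E)%E); last first.
      by rewrite integral_cst// [X in (_ * X)%E](probability_setT w) mule1.
    apply: ge0_le_integral => //.
    + by move=> t _; rewrite lee_fin powR_ge0.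
    + by apply: measurable_powR_EFin; exact: measurable_mdist.
    + move=> t _; rewrite lee_fin; apply: ge0_ler_powR.
      * exact: ltW.
      * by rewrite nnegrE mdist_ge0.
      * by rewrite nnegrE.
      * exact: fgc.
  - by apply: measurable_powR_EFin; apply: measurable_mdist;
    [exact: measurable_fst|exact: measurable_snd].
  - by move=> z; rewrite lee_fin powR_ge0.
have If := wasserstein_inf_fin_num mu nu.
have I0 : 0 <= fine (ereal_inf (transport_costs (sval mu) (sval nu))).
  apply: fine_ge0; apply: le_ereal_inf_tmp => x; exact: transport_cost_ge0.
rewrite -(fineK If) lee_fin => Ic.
have -> : c = (c `^ p) `^ p^-1 by rewrite -powRrM mulfV ?gt_eqF// powRr1.
by apply: ge0_ler_powR; rewrite ?nnegrE ?invr_ge0 ?powR_ge0 ?(ltW p0).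
Qed.

(** * Integration of a 1-Lipschitz function *)

Section LipschitzFunctional.
Variable u : X -> R.
Hypothesis ulip : forall x y, `|u x - u y| <= d x y.

Let mfu : measurable_fun setT (u : borel X -> R).
Proof. exact: mreal (lipschitz_continuous ulip). Qed.

(** Growth is at most linear in the distance to [point], and first moments are finite by
    [mean_lty]. *)
Lemma lipschitz_integrable (w : wasserstein_space X p) :
  (sval w).-integrable setT (EFin \o (u : borel X -> R)).
Proof.
have du : (sval w).-integrable setT
    (EFin \o (fun x : borel X => `|u point| + d x point)).
  rewrite (_ : EFin \o _ = (EFin \o cst (`|u point|)%R) \+
      (EFin \o (fun x : borel X => d x point)))%E; last exact/funext.
  apply: integrableD => //; first exact: finite_measure_integrable_cst.
  apply/integrableP; split; first by apply/measurable_EFinP; exact: mdistl.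
  under eq_integral do rewrite /= ger0_norm ?mdist_ge0//.
  apply: (mean_lty (p := p)) => //; first by move=> x; exact: mdist_ge0.
  exact: finite_momentP (svalP w).
apply: le_integrable du => //; first exact/measurable_EFinP.
move=> x _; rewrite lee_fin; apply: le_trans (ler_norm _).
have := ulip x point; have := ler_normD (u point) (u x - u point).
by rewrite subrKC; lra.
Qed.

Lemma integral_functional_law d' (T : measurableType d') (w : probability T R)
    (f : T -> borel X) (mu : wasserstein_space X p) :
  is_law w f (sval mu) ->
  w.-integrable setT (EFin \o (u \o f)) /\
  integral_functional p u mu = \int[w]_t u (f t).
Proof.
move=> muE; have iu := lipschitz_integrable mu.
by split; [exact: (integrable_law muE iu)|exact: (Rintegral_law muE iu)].
Qed.

(** Under any coupling the difference is the mean of [u z.1 - u z.2], bounded by the mean distance;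
    [powR_mean_le_moment] compares that with the cost. *)
Lemma integral_functional_lipschitz (mu nu : wasserstein_space X p) :
  `|integral_functional p u mu - integral_functional p u nu| <= W mu nu.
Proof.
apply: wasserstein_dist_ge => // pi /couplingP[l1 l2].
have [i1 ->] := integral_functional_law l1.
have [i2 ->] := integral_functional_law l2.
have md : measurable_fun setT (fun z : borel X * borel X => d z.1 z.2).
  by apply: measurable_mdist; [exact: measurable_fst|exact: measurable_snd].
apply: powR_mean_le_moment => //; first by move=> z; exact: mdist_ge0.
have iB : pi.-integrable setT (EFin \o (fun z => u z.1 - u z.2)).
  exact: (integrableB measurableT i1 i2).
rewrite -RintegralB//.
apply: (@le_trans _ _ (\int[pi]_z `|u z.1 - u z.2|)%:E).
  by rewrite lee_fin; exact: le_normr_Rintegral.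
rewrite /Rintegral fineK; last first.
  by apply: integrable_fin_num => //; exact: (integrable_abse iB).
apply: ge0_le_integral => //.
- by case/integrableP: (integrable_abse iB).
- exact/measurable_EFinP.
- by move=> z _; rewrite lee_fin.
Qed.

End LipschitzFunctional.

End WassersteinSpace.

(** * Descent rays and viscosity solutions *)

Section IsometricDescentRays.
Context {R : realType} {Y : Type}.
Variables (D : Y -> Y -> R) (v : Y -> R).
Hypothesis vlip : forall x y, `|v x - v y| <= D x y.

Definition descent_ray (G : R -> Y) := forall s t, 0 <= s -> 0 <= t ->
  D (G s) (G t) = `|s - t| /\ v (G s) - v (G t) = t - s.

Lemma descent_ray_negative_gradient_curve G : descent_ray G ->
  negative_gradient_curve D v `[0, +oo[ G.
Proof.
move=> GP; have ge0 t : `[0, +oo[%classic t = (0 <= t) :> Prop.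
  by rewrite /= in_itv/= andbT.
split; [split|split|].
- exact: interval_is_interval.
- by exists 0, 1; rewrite !ge0.
- move=> t; rewrite ge0 => t0; apply/cvgrPdist_le => e e0.
  rewrite near_withinE; near=> s; rewrite ge0 => s0.
  rewrite (GP s t s0 t0).1 sub0r normrN normr_id distrC; near: s.
  exact: cvgr_dist_le.
- move=> a b ab abI; apply: (@le_lt_trans _ _ (b - a)%:E); last exact: ltry.
  apply: ge_ereal_sup => _ [s sab <-]; rewrite lee_fin.
  have mem n : (n < (size s).+1)%N -> 0 <= nth b (a :: s) n.
    move=> ns; rewrite -ge0; apply: abI => /=; rewrite in_itv/=.
    by rewrite (itv_partition_nth_ge ns sab) (itv_partition_nth_le ns sab).
  (* Each chord has the length of its parameter interval, so the sum is a variation of the identity,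
     namely [b - a]. *)
  rewrite -(@nondecreasing_variation _ a b id s)//.
  rewrite /variation big_nat [leRHS]big_nat; apply: ler_sum => n /andP[_ ns] /=.
  by rewrite (GP _ _ (mem n (ltnW ns)) (mem n.+1 ns)).1 distrC.
- apply: aeW => t; rewrite ge0 => t0; exists 1; last exact: oner_neq0.
  apply: cvg_near_cst; rewrite near_withinE.
  near=> h => /=; rewrite in_itv/= andbT => th0.
  rewrite (GP _ _ th0 t0).1 addrAC subrr add0r divff// normr_eq0.
  by near: h; exact: nbhs_dnbhs_neq.
- move=> a b ab abI; have a0 : 0 <= a.
    by rewrite -ge0; apply: abI; rewrite /= in_itv/= lexx.
  have b0 := le_trans a0 ab.
  by rewrite (GP a b a0 b0).2 (GP b a b0 a0).1 ger0_norm// subr_ge0.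
Unshelve. all: by end_near. Qed.

(** The Lipschitz bound keeps the slope at most [1], and the points [G (r / 2)] of a ray attain the
    quotient [1] in every punctured ball. *)
Lemma descent_rays_strong_viscosity_solution :
  (forall y, exists2 G, G 0 = y & descent_ray G) ->
  strong_metric_viscosity_solution D v.
Proof.
move=> rays; split=> [|y]; last first.
  have [G G0 GP] := rays y; exists `[0, +oo[%classic, G, 0; split=> //.
  - exact: descent_ray_negative_gradient_curve.
  - by rewrite /= in_itv/= lexx.
  - by move=> t; rewrite /= in_itv/= andbT.
split=> y.
  by exists 1 => //; exists 1 => x z _ _; rewrite mul1r.
apply/eqP; rewrite eq_le descending_slope_le1//=.
apply: descending_slope_ge1 => r r0; have [G <- GP] := rays y.
have r2 : 0 < r / 2 by rewrite divr_gt0.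
have [GD Gv] := GP 0 (r / 2) (lexx 0) (ltW r2).
rewrite sub0r normrN gtr0_norm// in GD.
exists (G (r / 2)); rewrite GD; last by rewrite Gv subr0.
by rewrite r2/=; lra.
Qed.

End IsometricDescentRays.

Lemma locally_lipschitz_continuous {R : realType} {X : metricType R}
    (u : X -> R) : locally_lipschitz (@mdist R X) u -> continuous u.
Proof.
move=> lu x; have [r r0 [L uL]] := lu x.
(* [L] may be zero or negative, hence the positive substitute used as a divisor. *)
apply/cvgrPdist_le => e e0; have L0 : 0 < `|L| + 1 by rewrite ltr_wpDl.
near=> y.
have xr : mdist x x < r by rewrite mdistxx.
have yr : mdist x y < r.
  by near: y; exact: (metricType_numDomainType.cvgr_dist_lt (f := id)).
have ye : mdist x y <= e / (`|L| + 1).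
  near: y; apply: (metricType_numDomainType.cvgr_dist_le (f := id)) => //.
  by rewrite divr_gt0.
apply: (le_trans (uL x y xr yr)); rewrite ler_pdivlMr// in ye.
apply: le_trans ye; rewrite mulrC ler_wpM2l ?mdist_ge0//.
by have := ler_norm L; lra.
Unshelve. all: by end_near. Qed.

Theorem theorem1p13 (R : realType) (X : completeMetricType R) (p : R)
    (u : X -> R)
    (hsep : separable X)
    (hloc : locally_compact [set: X])
    (hncpt : ~ compact [set: X])
    (hgeod : geodesic_space (@mdist R X))
    (hp : 1 <= p)
    (hu : metric_viscosity_solution (@mdist R X) u) :
  strong_metric_viscosity_solution (wasserstein_dist X p)
    (integral_functional p u).
Proof.
have [/locally_lipschitz_continuous cu su] := hu.
have ulip : forall x y, `|u x - u y| <= mdist x y.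
  by apply: slope_le1_lipschitz => // z; rewrite su.
have su1 y : (1 <= descending_slope (@mdist R X) u y)%E by rewrite su.
have Ulip := integral_functional_lipschitz hsep hp ulip.
have [gamma [mg g0 gd gu]] := gradient_rays hsep hloc hgeod ulip su1.
apply: descent_rays_strong_viscosity_solution => // w.
(* The ray must start at [w] itself, an equality in the subtype, so this is built into the choice;
   negative times are clamped to [0]. *)
have /choice[G GP] t : exists mu : wasserstein_space X p,
    is_law (sval w) (gamma (Num.max t 0)) (sval mu) /\ (t = 0 -> mu = w).
  have [->|t0] := eqVneq t 0.
    by exists w; rewrite maxxx g0; split=> //; exact: is_law_id.
  have m0 : 0 <= Num.max t 0 by rewrite le_max lexx orbT.
  have [x|mu muP] := finite_moment_law hsep hp w (c := Num.max t 0)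
      (mg (Num.max t 0)).
    by rewrite -{2}[x]/(id x) -g0 gd// subr0 ger0_norm.
  by exists mu; split=> // /eqP; rewrite (negbTE t0).
have GL t : 0 <= t -> is_law (sval w) (gamma t) (sval (G t)).
  by move=> t0; have [+ _] := GP t; rewrite max_l.
exists G => [|s t s0 t0]; first exact: (GP 0).2.
(* Both integrals are pulled back to [w], where the difference of the integrands is the constant
   [t - s]. *)
have vE : integral_functional p u (G s) - integral_functional p u (G t) = t - s.
  have [i1 ->] := integral_functional_law hp ulip (GL s s0).
  have [i2 ->] := integral_functional_law hp ulip (GL t t0).
  rewrite -RintegralB//.
  rewrite (@eq_Rintegral _ _ _ _ _ (fun=> t - s)); last first.
    by move=> x _ /=; have := gu s x s0; have := gu t x t0; lra.
  rewrite Rintegral_cst// [X in fine X](probability_setT (sval w)).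
  by rewrite mulr1.
(* The upper bound comes from the joint law of the two positions, the lower one from the drop and
   the Lipschitz bound of the functional. *)
split=> //; apply/le_anti/andP; split.
  apply: (wasserstein_dist_law_le hsep hp (GL s s0) (GL t t0)) => // x.
  by rewrite gd.
by rewrite distrC -vE.
Qed.
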